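(* Let $\mathbb{K}$ be a field, let $P$ and $Q$ be algebraic polymatroids over $\mathbb{K}$ on the same finite set $E=\{1,\dots,n\}$, and let $\alpha\in\mathbb{Z}_{\ge0}^n$ be a common cage of both $P$ and $Q$. Then the polymatroid intersection $P\wedge_\alpha Q$ is algebraic over $\mathbb{K}$.
   Context: A polymatroid $P$ on a finite set $E$ is given by a rank function $\mathrm{rk}:2^E\to\mathbb{Z}_{\ge0}$ that is normalized ($\mathrm{rk}(\emptyset)=0$), increasing and submodular. Its set of bases $\mathcal{B}_P$ consists of the $\beta\in\mathbb{Z}_{\ge0}^E$ with $\sum_{i\in E}\beta_i=\mathrm{rk}(E)$ and $\sum_{i\in A}\beta_i\le\mathrm{rk}(A)$ for all $A\subsetneq E$; $P$ is determined by $\mathcal{B}_P$, and the sets $\mathcal{B}_P$ are exactly the M-convex sets (nonempty subsets of some $\{\gamma\in\mathbb{Z}_{\ge0}^E:\sum\gamma_i=r\}$ satisfying: for all $u,v$ in the set and $i$ with $u_i<v_i$ there is $j$ with $u_j>v_j$ such that $u-e_j+e_i$ and $v-e_i+e_j$ are in the set). A cage for $P$ is $\alpha\in\mathbb{Z}_{\ge0}^E$ with $\mathrm{rk}(\{i\})\le\alpha_i$ for all $i$. For two polymatroids $P,Q$ with the same cage $\alpha$, $P\wedge_\alpha Q$ is the polymatroid whose bases are the componentwise-minimal elements of $\{\beta_P\cap_\alpha\beta_Q:\beta_P\in\mathcal{B}_P,\beta_Q\in\mathcal{B}_Q\}$, where $(\beta\cap_\alpha\gamma)_i=\max\{\beta_i+\gamma_i-\alpha_i,0\}$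 (these are known to form an M-convex set). A polymatroid $P$ on $E$ is algebraic over $\mathbb{K}$ if there are a field extension $L/\mathbb{K}$ and intermediate fields $\mathbb{K}\subseteq L_i\subseteq L$ ($i\in E$) such that $\mathrm{rk}(S)=\operatorname{tr.deg}_{\mathbb{K}}\mathbb{K}\big(\bigcup_{i\in S}L_i\big)$ for all $S\subseteq E$. *)

(* Defs.v *)
From mathcomp Require Import all_boot all_order all_algebra.
From mathcomp Require Import zify mpoly.

Set Implicit Arguments.
Unset Strict Implicit.
Unset Printing Implicit Defensive.

Import Order.TTheory GRing.Theory Num.Theory.

Record polymatroid (E : finType) := Polymatroid {
  rk :> {set E} -> nat;
  rk_set0 : rk set0 = 0;
  rk_mono : forall A B : {set E}, A \subset B -> rk A <= rk B;
  rk_submod : forall A B : {set E}, rk (A :|: B) + rk (A :&: B) <= rk A + rk B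
}.

Definition is_basis (E : finType) (P : polymatroid E) (b : {ffun E -> nat}) : Prop :=
  \sum_i b i = P [set: E] /\
  forall A : {set E}, A \proper [set: E] -> \sum_(i in A) b i <= P A.

Definition is_cage (E : finType) (a : {ffun E -> nat}) (P : polymatroid E) : Prop :=
  forall i, P [set i] <= a i.

(* Truncated subtraction on nat gives max(b_i + c_i - a_i, 0). *)
Definition cap_vec (E : finType) (a b c : {ffun E -> nat}) : {ffun E -> nat} :=
  [ffun i => b i + c i - a i].

Definition basis_caps (E : finType) (a : {ffun E -> nat}) (P Q : polymatroid E)
    (x : {ffun E -> nat}) : Prop :=
  exists b c, [/\ is_basis P b, is_basis Q c & x = cap_vec a b c].

Definition minimal_vec (E : finType) (S : {ffun E -> nat} -> Prop)
    (x : {ffun E -> nat}) : Prop :=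
  S x /\ forall y, S y -> (forall i, y i <= x i) -> y = x.

(* The minimal elements of basis_caps a P Q are the bases of a
   polymatroid.  With s(X) = rk_P(E) - rk_P(E\X) + rk_Q(E) - rk_Q(E\X) - a(X)
   and p(A) = max_{X <= A} s(X), its rank function is A |-> p(E) - p(E\A); the
   key point is the discrete sandwich theorem for set functions. *)

Lemma sumn_setUI (E : finType) (m : E -> nat) (A B : {set E}) :
  \sum_(i in A :|: B) m i + \sum_(i in A :&: B) m i =
  \sum_(i in A) m i + \sum_(i in B) m i.
Proof.
rewrite [X in X + _]big_mkcond [X in _ + X]big_mkcond.
rewrite [X in _ = X + _]big_mkcond [X in _ = _ + X]big_mkcond /=.
rewrite -!big_split /=; apply: eq_bigr => i _; rewrite !inE.
by case: (i \in A); case: (i \in B); rewrite /= ?addn0.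
Qed.

Section IntegerSetFunctions.
Local Open Scope ring_scope.

Lemma sumz_setUI (E : finType) (m : E -> int) (A B : {set E}) :
  \sum_(i in A :|: B) m i + \sum_(i in A :&: B) m i =
  \sum_(i in A) m i + \sum_(i in B) m i.
Proof.
rewrite [X in X + _]big_mkcond [X in _ + X]big_mkcond.
rewrite [X in _ = X + _]big_mkcond [X in _ = _ + X]big_mkcond /=.
rewrite -!big_split /=; apply: eq_bigr => i _; rewrite !inE.
by case: (i \in A); case: (i \in B); rewrite /= ?addr0 ?add0r.
Qed.

Lemma sumz_setT (E : finType) (m : E -> int) :
  \sum_(i in [set: E]) m i = \sum_i m i.
Proof. by apply: eq_bigl => i; rewrite inE. Qed.

Lemma Posz_sum (E : finType) (m : E -> nat) (A : {set E}) :
  ((\sum_(i in A) m i)%N)%:Z = \sum_(i in A) (m i)%:Z.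
Proof. exact: (big_morph Posz PoszD (erefl _)). Qed.

Lemma setD1_U1 (E : finType) (e : E) (X : {set E}) :
  X = (if e \in X then e |: (X :\ e) else X :\ e).
Proof.
case: ifP => h; first by rewrite setD1K.
by apply/setP => i; rewrite !inE; case: eqP => // ->; rewrite h.
Qed.

Definition submodular (E : finType) (f : {set E} -> int) : Prop :=
  forall X Y, f (X :|: Y) + f (X :&: Y) <= f X + f Y.

Definition supermodular (E : finType) (g : {set E} -> int) : Prop :=
  forall X Y, g X + g Y <= g (X :|: Y) + g (X :&: Y).

Lemma between_ints (E : finType) (lo hi : E -> int) (e0 : E) :
  (forall x y, lo x <= hi y) ->
  exists t : int, forall x, lo x <= t /\ t <= hi x.
Proof.
move=> h; have [x _ hx] := @Order.TotalTheory.arg_maxP _ _ E e0 xpredT lo isT.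
by exists (lo x) => y; split; [exact: hx | exact: h].
Qed.

Lemma discrete_sandwich (E : finType) (s : seq E) (f g : {set E} -> int) :
  submodular f -> supermodular g -> f set0 = 0 -> g set0 = 0 ->
  (forall X, g X <= f X) ->
  exists m : E -> int, forall X : {set E}, {subset X <= s} ->
    g X <= \sum_(i in X) m i /\ \sum_(i in X) m i <= f X.
Proof.
elim: s f g => [|e s IH] f g subf supg f0 g0 gf.
  exists (fun=> 0) => X Xs; have -> : X = set0.
    by apply/setP => i; rewrite inE; apply/negP => /Xs.
  by rewrite big_set0 f0 g0.
have [t ht] : exists t : int, forall X : {set E},
    g (e |: X :\ e) - f (X :\ e) <= t /\ t <= f (e |: X :\ e) - g (X :\ e).
  apply: (between_ints (lo := fun X => g (e |: X :\ e) - f (X :\ e))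
    (hi := fun X => f (e |: X :\ e) - g (X :\ e)) set0) => X Y.
  have h1 := supg (e |: X :\ e) (Y :\ e).
  have h2 := subf (X :\ e) (e |: Y :\ e).
  have e1 : (e |: X :\ e) :&: (Y :\ e) = (X :\ e) :&: (Y :\ e).
    by apply/setP => i; rewrite !inE; case: eqP.
  have e2 : (X :\ e) :&: (e |: Y :\ e) = (X :\ e) :&: (Y :\ e).
    by apply/setP => i; rewrite !inE; case: eqP.
  have e3 : (X :\ e) :|: (e |: Y :\ e) = (e |: X :\ e) :|: (Y :\ e).
    by apply/setP => i; rewrite !inE; case: eqP.
  rewrite e1 in h1; rewrite e2 e3 in h2.
  have := gf ((e |: X :\ e) :|: (Y :\ e)).
  have := gf ((X :\ e) :&: (Y :\ e)).
  lia.
pose f' X := Num.min (f (X :\ e)) (f (e |: X :\ e) - t).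
pose g' X := Num.max (g (X :\ e)) (g (e |: X :\ e) - t).
have eU X Y : (X :|: Y) :\ e = (X :\ e) :|: (Y :\ e).
  by apply/setP => i; rewrite !inE; case: eqP.
have eI X Y : (X :&: Y) :\ e = (X :\ e) :&: (Y :\ e).
  by apply/setP => i; rewrite !inE; case: eqP.
have U1 X Y : (e |: X) :|: Y = e |: (X :|: Y) by rewrite setUA.
have U2 X Y : X :|: (e |: Y) = e |: (X :|: Y) by rewrite setUCA.
have U3 X Y : (e |: X) :|: (e |: Y) = e |: (X :|: Y).
  by rewrite U1 U2 setUA setUid.
have I1 X Y : (e |: X :\ e) :&: (Y :\ e) = (X :\ e) :&: (Y :\ e).
  by apply/setP => i; rewrite !inE; case: eqP.
have I2 X Y : (X :\ e) :&: (e |: Y :\ e) = (X :\ e) :&: (Y :\ e).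
  by apply/setP => i; rewrite !inE; case: eqP.
have I3 X Y : (e |: X) :&: (e |: Y) = e |: (X :&: Y) by rewrite setUIr.
have subf' : submodular f'.
  move=> X Y; rewrite /f' !eU !eI.
  have h0 := subf (X :\ e) (Y :\ e).
  have := subf (e |: X :\ e) (Y :\ e); rewrite U1 I1 => h1.
  have := subf (X :\ e) (e |: Y :\ e); rewrite U2 I2 => h2.
  have := subf (e |: X :\ e) (e |: Y :\ e); rewrite U3 I3 => h3.
  lia.
have supg' : supermodular g'.
  move=> X Y; rewrite /g' !eU !eI.
  have h0 := supg (X :\ e) (Y :\ e).
  have := supg (e |: X :\ e) (Y :\ e); rewrite U1 I1 => h1.
  have := supg (X :\ e) (e |: Y :\ e); rewrite U2 I2 => h2.
  have := supg (e |: X :\ e) (e |: Y :\ e); rewrite U3 I3 => h3.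
  lia.
have [t1 t2] := ht set0; rewrite !set0D ?f0 ?g0 in t1 t2.
have [|||m hm] := IH f' g' subf' supg'.
- by rewrite /f' set0D f0; lia.
- by rewrite /g' set0D g0; lia.
- move=> X; rewrite /f' /g'; have [h1 h2] := ht X.
  have := gf (X :\ e); have := gf (e |: X :\ e); lia.
exists (fun i => if i == e then t else m i) => X Xs.
have [|lo hi] := hm (X :\ e).
  by move=> i; rewrite !inE => /andP[ie /Xs]; rewrite inE (negPf ie).
have Em : \sum_(i in X :\ e) (if i == e then t else m i) = \sum_(i in X :\ e) m i.
  by apply: eq_bigr => i; rewrite !inE => /andP[/negPf ->].
have DD : X :\ e :\ e = X :\ e by rewrite setDDl setUid.
move: lo hi; rewrite /f' /g' DD => lo hi.
case: (boolP (e \in X)) => eX.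
  by rewrite (big_setD1 e eX) /= eqxx Em; rewrite setD1K // in lo hi; lia.
have XE : X :\ e = X by have := setD1_U1 e X; rewrite (negPf eX).
by rewrite XE in Em lo hi; rewrite Em; lia.
Qed.

Lemma supermodular_base (E : finType) (g : {set E} -> int) (m : E -> int) :
  supermodular g -> g set0 = 0 ->
  (forall X : {set E}, g X <= \sum_(i in X) m i) ->
  exists z : E -> int, [/\ forall i, z i <= m i,
    forall X : {set E}, g X <= \sum_(i in X) z i &
    \sum_i z i = g [set: E]].
Proof.
move=> supg g0.
have [k] : exists k : nat, \sum_i m i <= g [set: E] + k%:Z.
  by exists (absz (\sum_i m i - g [set: E])%R); lia.
elim: k m => [|k IH] m hk gm.
  exists m; split=> //; have := gm [set: E].
  by rewrite sumz_setT; lia.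
have [/existsP[i /forallP hi]|] := boolP [exists i, forall X : {set E},
   (i \in X) ==> (g X < \sum_(j in X) m j)].
  pose m' j := m j - (j == i)%:Z.
  have sm' (X : {set E}) : \sum_(j in X) m' j = \sum_(j in X) m j - (i \in X)%:Z.
    rewrite /m' sumrB; congr (_ - _); case: (boolP (i \in X)) => iX.
      rewrite (bigD1 i) //= eqxx big1 ?addr0 // => j /andP[_ /negPf ->] //.
    by rewrite big1 // => j jX; case: eqP => // ji; rewrite -ji jX in iX.
  have [||z [z1 z2 z3]] := IH m'.
  - by have := sm' [set: E]; rewrite inE !sumz_setT; lia.
  - move=> X; rewrite sm'; have := hi X; have := gm X.
    by case: (i \in X) => /=; lia.
  by exists z; split=> // j; have := z1 j; rewrite /m'; case: (j == i); lia.
rewrite negb_exists => /forallP nex.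
have tightE : \sum_(i in [set: E]) m i = g [set: E].
  have cov (i : E) : {X : {set E} | i \in X & \sum_(j in X) m j == g X}.
    apply: sig2W; have := nex i; rewrite negb_forall => /existsP[X].
    by rewrite negb_imply => /andP[iX nlt]; exists X => //; apply/eqP; have := gm X; lia.
  pose C i := s2val (cov i).
  have -> : [set: E] = \bigcup_i C i.
    apply/setP => i; rewrite inE; apply/esym/bigcupP; exists i => //.
    exact: s2valP (cov i).
  pose tight (X : {set E}) := \sum_(j in X) m j = g X.
  suff : tight (\bigcup_i C i) by [].
  rewrite /tight; elim/big_ind: (\bigcup_i C i).
  - by rewrite big_set0 g0.
  - move=> X Y hX hY; have := sumz_setUI m X Y; have := supg X Y.
    by have := gm (X :|: Y); have := gm (X :&: Y); lia.
  - by move=> i _; apply/eqP; exact: s2valP' (cov i).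
by exists m; split=> //; rewrite -tightE sumz_setT.
Qed.

End IntegerSetFunctions.

Section Intersection.
Local Open Scope ring_scope.

Definition corank (E : finType) (P : polymatroid E) (X : {set E}) : int :=
  (P [set: E])%:Z - (P (~: X))%:Z.

Lemma corank_super (E : finType) (P : polymatroid E) : supermodular (corank P).
Proof.
move=> X Y; rewrite /corank setCU setCI.
by have := rk_submod P (~: X) (~: Y); lia.
Qed.

Lemma corank0 (E : finType) (P : polymatroid E) : corank P set0 = 0.
Proof. by rewrite /corank setC0 subrr. Qed.

Lemma basisP (E : finType) (P : polymatroid E) (b : {ffun E -> nat}) :
  is_basis P b <->
  (\sum_i (b i)%:Z = (P [set: E])%:Z /\
   forall X : {set E}, corank P X <= \sum_(i in X) (b i)%:Z).
Proof.
have sT := sumz_setT (fun i => (b i)%:Z).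
have sT' : (\sum_i b i)%N = (\sum_(i in [set: E]) b i)%N.
  by apply: eq_bigl => i; rewrite inE.
have sC (X : {set E}) : (\sum_(i in X) b i + \sum_(i in ~: X) b i)%N = (\sum_i b i)%N.
  by have := sumn_setUI b X (~: X); rewrite setUCr setICr big_set0 addn0 sT'.
rewrite -sT -Posz_sum -sT'; split=> -[h1 h2]; split.
- by rewrite h1.
- move=> X; rewrite -Posz_sum /corank; have := sC X.
  have [->|/set0Pn[e eX]] := eqVneq X set0; first by rewrite setC0; lia.
  have := h2 (~: X); rewrite properT.
  have -> : ~: X != [set: E].
    by apply/negP => /eqP/setP/(_ e); rewrite !inE eX.
  by move=> /(_ isT); lia.
- lia.
- move=> A _; have := h2 (~: A); rewrite /corank setCK -Posz_sum.
  by have := sC A; lia.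
Qed.

Definition excess (E : finType) (a : {ffun E -> nat}) (P Q : polymatroid E)
    (X : {set E}) : nat :=
  (P [set: E] + Q [set: E] - (P (~: X) + Q (~: X) + \sum_(i in X) a i))%N.

Definition max_excess (E : finType) (a : {ffun E -> nat}) (P Q : polymatroid E)
    (A : {set E}) : nat :=
  (\max_(X : {set E} | X \subset A) excess a P Q X)%N.

Lemma excess_le (E : finType) (a : {ffun E -> nat}) (P Q : polymatroid E)
    (X A : {set E}) : X \subset A -> (excess a P Q X <= max_excess a P Q A)%N.
Proof. by move=> h; exact: (bigop.leq_bigmax_cond X). Qed.

Lemma max_excess_ex (E : finType) (a : {ffun E -> nat}) (P Q : polymatroid E)
    (A : {set E}) :
  exists2 X : {set E}, X \subset A & max_excess a P Q A = excess a P Q X.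
Proof.
have [|X XA hX] := @eq_bigmax_cond _ [pred X : {set E} | X \subset A]
  (excess a P Q); last by exists X => //; exact: hX.
by apply/card_gt0P; exists set0; rewrite inE sub0set.
Qed.

Lemma max_excess_mono (E : finType) (a : {ffun E -> nat}) (P Q : polymatroid E)
    (A B : {set E}) :
  A \subset B -> (max_excess a P Q A <= max_excess a P Q B)%N.
Proof.
move=> AB; have [X XA ->] := max_excess_ex a P Q A.
exact/excess_le/(subset_trans XA AB).
Qed.

Lemma max_excess0 (E : finType) (a : {ffun E -> nat}) (P Q : polymatroid E) :
  max_excess a P Q set0 = 0%N.
Proof.
have [X] := max_excess_ex a P Q set0; rewrite subset0 => /eqP -> ->.
by rewrite /excess setC0 big_set0; lia.
Qed.

Lemma max_excess_super (E : finType) (a : {ffun E -> nat}) (P Q : polymatroid E)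
    (A B : {set E}) :
  (max_excess a P Q A + max_excess a P Q B <=
   max_excess a P Q (A :|: B) + max_excess a P Q (A :&: B))%N.
Proof.
have hA := max_excess_mono a P Q (subsetUl A B).
have hB := max_excess_mono a P Q (subsetUr A B).
have [X XA eX] := max_excess_ex a P Q A.
have [Y YB eY] := max_excess_ex a P Q B.
have hU := excess_le a P Q (setUSS XA YB).
have hI := excess_le a P Q (setISS XA YB).
move: eX eY hU hI; rewrite /excess setCU setCI.
have := sumn_setUI a X Y.
have := rk_submod P (~: X) (~: Y); have := rk_submod Q (~: X) (~: Y); lia.
Qed.

Lemma basis_caps_lower (E : finType) (a : {ffun E -> nat}) (P Q : polymatroid E)
    (x : {ffun E -> nat}) (A : {set E}) :
  basis_caps a P Q x -> (max_excess a P Q A <= \sum_(i in A) x i)%N.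
Proof.
case=> b [c [/basisP[_ hb] /basisP[_ hc] ->]].
have [X XA ->] := max_excess_ex a P Q A.
apply: (@leq_trans (\sum_(i in X) cap_vec a b c i)%N); last first.
  rewrite [leqRHS](big_setID X) /= (setIidPr XA); exact: leq_addr.
have h : (\sum_(i in X) b i + \sum_(i in X) c i <=
          \sum_(i in X) a i + \sum_(i in X) cap_vec a b c i)%N.
  rewrite -!big_split /=; apply: leq_sum => i _; rewrite ffunE; lia.
have := hb X; have := hc X; rewrite /corank -!Posz_sum /excess; lia.
Qed.

Lemma corank_base (E : finType) (P : polymatroid E) (m : E -> int) :
  (forall X : {set E}, corank P X <= \sum_(i in X) m i) ->
  exists2 b : {ffun E -> nat}, is_basis P b & forall i, (b i)%:Z <= m i.
Proof.
move=> hm; have [z [z1 z2 z3]] :=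
  supermodular_base (@corank_super E P) (corank0 P) hm.
have z0 i : 0 <= z i.
  have := z2 [set i]; rewrite big_set1 /corank.
  by have := rk_mono P (subsetT (~: [set i])); lia.
have bz i : ([ffun i => absz (z i)] i)%:Z = z i by rewrite ffunE; have := z0 i; lia.
exists [ffun i => absz (z i)] => [|i]; last by rewrite bz.
apply/basisP; split.
  rewrite (eq_bigr z) // z3 /corank setCT rk_set0; lia.
by move=> X; rewrite (eq_bigr z).
Qed.

Lemma basis_caps_below (E : finType) (a : {ffun E -> nat}) (P Q : polymatroid E)
    (y : {ffun E -> nat}) :
  (forall A : {set E}, (max_excess a P Q A <= \sum_(i in A) y i)%N) ->
  exists2 x, basis_caps a P Q x & forall i, (x i <= y i)%N.
Proof.
move=> hy; pose w i : int := (y i)%:Z + (a i)%:Z.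
have sw (X : {set E}) : \sum_(i in X) w i =
    ((\sum_(i in X) y i)%N)%:Z + ((\sum_(i in X) a i)%N)%:Z.
  by rewrite !Posz_sum -big_split.
pose f (X : {set E}) : int := \sum_(i in X) w i - corank P X.
have [|||||m hm] := @discrete_sandwich E (enum E) f (corank Q).
- move=> X Y; rewrite /f; have := sumz_setUI w X Y.
  by have := @corank_super E P X Y; lia.
- exact: corank_super.
- by rewrite /f big_set0 corank0.
- exact: corank0.
- move=> X; rewrite /f sw; have := hy X.
  have := excess_le a P Q (subxx X); rewrite /excess /corank; lia.
have hm1 (X : {set E}) : corank Q X <= \sum_(i in X) m i.
  by have [] := hm X => // i _; rewrite mem_enum.
have hm2 (X : {set E}) : corank P X <= \sum_(i in X) (w i - m i).
  have [] := hm X => [i _|_]; first by rewrite mem_enum.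
  by rewrite /f sumrB !lerBrDr addrC.
have [c Bc hc] := corank_base hm1; have [b Bb hb] := corank_base hm2.
exists (cap_vec a b c); first by exists b, c.
by move=> i; rewrite ffunE; have := hb i; have := hc i; rewrite /w; lia.
Qed.

Definition intersection_rk (E : finType) (a : {ffun E -> nat})
    (P Q : polymatroid E) (A : {set E}) : nat :=
  (max_excess a P Q [set: E] - max_excess a P Q (~: A))%N.

Lemma intersection_rk_polymatroid (E : finType) (a : {ffun E -> nat})
    (P Q : polymatroid E) :
  {R : polymatroid E | R =1 intersection_rk a P Q}.
Proof.
have h0 : intersection_rk a P Q set0 = 0%N.
  by rewrite /intersection_rk setC0 subnn.
have hm (A B : {set E}) : A \subset B ->
    (intersection_rk a P Q A <= intersection_rk a P Q B)%N.
  rewrite -setCS => /(max_excess_mono a P Q); rewrite /intersection_rk; lia.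
have hs (A B : {set E}) :
    (intersection_rk a P Q (A :|: B) + intersection_rk a P Q (A :&: B) <=
     intersection_rk a P Q A + intersection_rk a P Q B)%N.
  rewrite /intersection_rk setCU setCI.
  have := max_excess_super a P Q (~: A) (~: B).
  have := max_excess_mono a P Q (subsetT (~: A :|: ~: B)).
  have := max_excess_mono a P Q (subsetT (~: A :&: ~: B)).
  have := max_excess_mono a P Q (subsetT (~: A)).
  have := max_excess_mono a P Q (subsetT (~: B)).
  lia.
by exists (Polymatroid h0 hm hs).
Qed.

Lemma eq_ffun_sum (E : finType) (x y : {ffun E -> nat}) :
  (forall i, (x i <= y i)%N) -> (\sum_i y i <= \sum_i x i)%N -> x = y.
Proof.
move=> xy s; apply/ffunP => i; apply/eqP.
have leif_xy j (_ : true) : (x j <= y j ?= iff (x j == y j))%N by apply/leqifP; case: eqP (xy j) => [->|]; lia.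
have [h1 h2] := leqif_sum leif_xy.
have /forallP/(_ i) // : [forall j, x j == y j].
by rewrite -h2 eqn_leq h1 s.
Qed.

Lemma intersection_exists (E : finType) (a : {ffun E -> nat})
    (P Q : polymatroid E) :
  {R : polymatroid E | forall b, is_basis R b <-> minimal_vec (basis_caps a P Q) b}.
Proof.
have [R hR] := intersection_rk_polymatroid a P Q; exists R => b.
have sT (x : {ffun E -> nat}) : (\sum_i x i)%N = (\sum_(i in [set: E]) x i)%N.
  by apply: eq_bigl => i; rewrite inE.
have coR X : corank R X = (max_excess a P Q X)%:Z.
  rewrite /corank !hR /intersection_rk setCT setCK max_excess0.
  by have := max_excess_mono a P Q (subsetT X); lia.
have RT : R [set: E] = max_excess a P Q [set: E].
  by rewrite hR /intersection_rk setCT max_excess0 subn0.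
split.
  move=> Bb; have [b1 _] := Bb; case/basisP: Bb => _ b2.
  have lowb x : basis_caps a P Q x -> (forall i, (x i <= b i)%N) -> x = b.
    move=> Sx xb; apply: eq_ffun_sum => //.
    by rewrite b1 RT sT; exact: basis_caps_lower.
  have [|x Sx xb] := @basis_caps_below E a P Q b.
    by move=> A; have := b2 A; rewrite coR -Posz_sum.
  by have xE := lowb x Sx xb; rewrite xE in Sx; split=> // y /lowb.
case=> Sb minb; have [|z Bz zb] := @corank_base E R (fun i => (b i)%:Z).
  by move=> X; rewrite coR -Posz_sum lez_nat; exact: basis_caps_lower.
have [|x Sx xz] := @basis_caps_below E a P Q z.
  by case/basisP: Bz => _ z2 A; have := z2 A; rewrite coR -Posz_sum.
have xb : x = b.
  by apply: minb => // i; apply: leq_trans (xz i) _; have := zb i.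
suff -> : b = z by [].
by apply/ffunP => i; apply/eqP; rewrite eqn_leq -{1}xb xz; have := zb i.
Qed.

End Intersection.

(* The rank function is pinned down by the property in the type of
   intersection_exists, since a polymatroid is determined by its bases.  No
   cage hypothesis is needed for existence. *)
Definition polymatroid_intersection (E : finType) (a : {ffun E -> nat})
    (P Q : polymatroid E) : polymatroid E :=
  sval (intersection_exists a P Q).

Lemma basis_polymatroid_intersection (E : finType) (a : {ffun E -> nat})
    (P Q : polymatroid E) (b : {ffun E -> nat}) :
  is_basis (polymatroid_intersection a P Q) b <->
  minimal_vec (basis_caps a P Q) b.
Proof. exact: (svalP (intersection_exists a P Q)). Qed.

Section Transcendence.
Local Open Scope ring_scope.

(* Extensions are of arbitrary degree, so fieldExtType does not apply: an
   extension of K is a field morphism, and subfields are Prop-valued. *)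
Definition is_subfield (L : fieldType) (F : L -> Prop) : Prop :=
  [/\ F 1, forall x y, F x -> F y -> F (x - y) &
      forall x y, F x -> F y -> F (x / y)].

Definition intermediate_field (K L : fieldType) (iota : {rmorphism K -> L})
    (F : L -> Prop) : Prop :=
  is_subfield F /\ forall k, F (iota k).

Definition adjoin (K L : fieldType) (iota : {rmorphism K -> L})
    (S : L -> Prop) (z : L) : Prop :=
  forall F : L -> Prop, intermediate_field iota F ->
    (forall x, S x -> F x) -> F z.

Definition alg_independent (K L : fieldType) (iota : {rmorphism K -> L})
    (d : nat) (x : 'I_d -> L) : Prop :=
  forall p : {mpoly K[d]}, (map_mpoly iota p).@[x] = 0 -> p = 0.

Definition algebraic_over (L : fieldType) (F : L -> Prop) (z : L) : Prop :=
  exists p : {poly L}, [/\ p != 0, forall i, F p`_i & root p z].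

Definition trdeg_eq (K L : fieldType) (iota : {rmorphism K -> L})
    (F : L -> Prop) (d : nat) : Prop :=
  exists x : 'I_d -> L,
    [/\ forall i, F (x i),
        alg_independent iota x &
        forall z, F z -> algebraic_over (adjoin iota (fun y => exists i, y = x i)) z].

End Transcendence.

Definition algebraic_polymatroid (K : fieldType) (E : finType)
    (P : polymatroid E) : Prop :=
  exists (L : fieldType) (iota : {rmorphism K -> L}) (Li : E -> L -> Prop),
    (forall i, intermediate_field iota (Li i)) /\
    forall S : {set E},
      trdeg_eq iota (adjoin iota (fun y => exists2 i, i \in S & Li i y)) (P S).

(* Main.v *)
Require Import Defs.
From HB Require Import structures.
From mathcomp Require Import all_boot all_order all_algebra.
From mathcomp Require Import fieldext mpoly zify boolp.

Set Implicit Arguments.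
Unset Strict Implicit.
Unset Printing Implicit Defensive.

Import Order.TTheory GRing.Theory Num.Theory.

(** Geometrically, P and Q are varieties with coordinates grouped into blocks
    indexed by E, and their intersection with respect to [alpha] is obtained from the
    product of the two varieties, whose rank function is P + Q, by cutting it with [alpha i]
    generic hypersurfaces in the coordinates of block i, for each i.  The proof follows this
    picture, one hypersurface at a time.

    On the combinatorial side, a generic cut in block e (of positive rank) replaces a rank
    function r by its truncation, which is r A - 1 if e lies in the closure of A and r A
    otherwise.  Doing this [alpha i] times for each i turns P + Q into the function that sends A to
    the maximal excess of the whole set minus that of the complement of A
    ([reduction_truncation], [reduction_loop], [reduction0]), and this is the rank function
    of the intersection, by duality between bases and coranks ([polymatroid_intersectionE]).

    On the algebraic side, two operations on representations over K are needed.  For the sum,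
    the two representations must be placed freely inside one field
    ([realizable_add]).  For the cut, one chooses an element t algebraic over block e but not
    over any flat that misses part of block e; over the ground field K(t) the given elements have the truncated
    ranks, but a representation over K is wanted, so t has to be specialized to an element
    algebraic over K ([realizable_truncate]).

    Both operations rest on one theorem, [specialization].  Given algebraically independent elements x
    and a finite list of elements algebraic over them, every point v outside some hypersurface h = 0 is
    the image of x under a map that carries all algebraic dependencies among the listed elements to
    dependencies.  It is proved by extending a ring homomorphism along one algebraic element at a
    time.  No separate argument is needed for the independence of the images: dependencies can
    only lower ranks, both the rank of a part and the rank of the whole over that part, and
    these add up to the total rank, which is preserved because v is chosen independent.  Hence
    no rank drops.

    Transcendence degree is handled through the exchange property of algebraic closure, as
    the rank function of a pregeometry. *)

(** * Repeated truncation of a rank function *)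

Section Reduction.
Variable E : finType.
Implicit Types (r : {set E} -> nat) (a : {ffun E -> nat}) (A B X : {set E}).

(** The excess of P and Q, with P + Q replaced by an arbitrary function [r]. *)
Definition gap r a X : nat := r [set: E] - (r (~: X) + \sum_(i in X) a i).

Definition max_gap r a A : nat := \max_(X : {set E} | X \subset A) gap r a X.

(** The rank function that remains after cutting [a i] times in each block [i]. *)
Definition reduction r a A : nat := max_gap r a [set: E] - max_gap r a (~: A).

(** The rank function after one generic cut in block [e], assumed of positive
    rank: the rank of [A] drops when the cut is a condition on [A], that is when block
    [e] lies in the closure of [A]. *)
Definition truncation r (e : E) A : nat := r A - (r (e |: A) == r A).

Definition incr a (e : E) : {ffun E -> nat} := [ffun i => a i + (i == e)].

Lemma sum_incr a e X : \sum_(i in X) incr a e i = \sum_(i in X) a i + (e \in X).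
Proof.
rewrite (eq_bigr (fun i => a i + (i == e))) => [|i _]; last by rewrite ffunE.
rewrite big_split /=; congr (_ + _); case: (boolP (e \in X)) => eX.
  by rewrite (bigD1 e) //= eqxx big1 // => i /andP[_ /negPf ->].
by rewrite big1 // => i iX; case: eqP => // ie; rewrite -ie iX in eX.
Qed.

Lemma max_gap_le r1 a1 r2 a2 A :
  (forall X, X \subset A -> exists2 Y : {set E}, Y \subset A & gap r1 a1 X <= gap r2 a2 Y) ->
  max_gap r1 a1 A <= max_gap r2 a2 A.
Proof.
move=> h; apply/bigmax_leqP => X /h[Y YA /leq_trans]; apply.
exact: (bigop.leq_bigmax_cond Y).
Qed.

Definition rank_like r : Prop :=
  [/\ r set0 = 0, forall A B, A \subset B -> r A <= r B &
      forall A B, r (A :|: B) <= r A + r B].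

Lemma sum_setD1 a X e : \sum_(i in X) a i = \sum_(i in X :\ e) a i + (if e \in X then a e else 0).
Proof.
case: ifP => eX; first by rewrite (big_setD1 e eX) addnC.
by rewrite addn0; apply: eq_bigl => i; rewrite !inE; case: eqP => // ->; rewrite eX.
Qed.

Lemma setC_D1 X e : ~: (X :\ e) = e |: ~: X.
Proof. by apply/setP => i; rewrite !inE negb_and negbK. Qed.

(** The gaps of the two sides agree set by set, except for sets [X] containing [e]
    with [e] in the closure of the complement of [X]; there the truncated gap of [X] is
    bounded by the other gap of [X :\ e].  So the maxima agree. *)
Lemma reduction_truncation r a e : rank_like r -> 0 < r [set e] ->
  reduction (truncation r e) a =1 reduction r (incr a e).
Proof.
move=> [r0 rm rs] re.
suff h A : max_gap (truncation r e) a A = max_gap r (incr a e) A.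
  by move=> A; rewrite /reduction !h.
have pos B : r (e |: B) = r B -> 0 < r B.
  move=> <-; apply: leq_trans re (rm _ _ _); exact: subsetUl.
have T1 : truncation r e setT = r setT - 1.
  by rewrite /truncation setUT eqxx.
apply/eqP; rewrite eqn_leq; apply/andP; split; apply: max_gap_le => X XA.
  have [eX|eX] := boolP (e \in X); last first.
    exists X => //; rewrite /gap T1 sum_incr (negPf eX) addn0 /truncation.
    have eC : e |: ~: X = ~: X by apply/setP => i; rewrite !inE; case: eqP => // ->; rewrite eX.
    by have := pos (~: X); rewrite eC eqxx => /(_ erefl); lia.
  have [E1|E1] := eqVneq (r (e |: ~: X)) (r (~: X)).
    exists (X :\ e); first exact: subset_trans (subsetDl _ _) XA.
    rewrite /gap T1 sum_incr /truncation E1 eqxx setC_D1 E1 !inE eqxx /= addn0.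
    rewrite (sum_setD1 a X e) eX; have := pos _ E1; lia.
  exists X => //; rewrite /gap T1 sum_incr eX /truncation (negPf E1) /=; lia.
have [eX|eX] := boolP (e \in X).
  exists X => //; rewrite /gap T1 sum_incr eX /truncation; case: eqP => _; lia.
exists X => //; rewrite /gap T1 sum_incr (negPf eX) addn0 /truncation.
have eC : e |: ~: X = ~: X by apply/setP => i; rewrite !inE; case: eqP => // ->; rewrite eX.
have := pos (~: X); rewrite eC eqxx => /(_ erefl); lia.
Qed.

(** If block [e] has rank zero, then [e] can be dropped from every set without
    decreasing its gap, and only the sets containing [e] see the value at [e]. *)
Lemma reduction_loop r a e : rank_like r -> r [set e] = 0 ->
  reduction r a =1 reduction r (incr a e).
Proof.
move=> [r0 rm rs] re.
suff h A : max_gap r a A = max_gap r (incr a e) A.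
  by move=> A; rewrite /reduction !h.
apply/eqP; rewrite eqn_leq; apply/andP; split; apply: max_gap_le => X XA; last first.
  by exists X => //; rewrite /gap sum_incr; lia.
exists (X :\ e); first exact: subset_trans (subsetDl _ _) XA.
rewrite /gap sum_incr !inE eqxx /= addn0 (sum_setD1 a X e) setC_D1.
have := rs [set e] (~: X); rewrite re; lia.
Qed.

Lemma reduction0 r : rank_like r -> reduction r [ffun=> 0] =1 r.
Proof.
move=> [r0 rm rs] A.
have h B : max_gap r [ffun=> 0] B = r setT - r (~: B).
  have g X : gap r [ffun=> 0] X = r setT - r (~: X).
    by rewrite /gap big1 ?addn0 // => i _; rewrite ffunE.
  apply/eqP; rewrite eqn_leq; apply/andP; split.
    by apply/bigmax_leqP => X XB; rewrite g leq_sub2l // rm // setCS.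
  by rewrite -g; exact: (bigop.leq_bigmax_cond B).
rewrite /reduction !h setCT r0 setCK; have := rm A setT (subsetT _); lia.
Qed.

End Reduction.

(** * The rank function of the intersection *)

Section IntersectionRank.
Local Open Scope ring_scope.
Variable E : finType.
Implicit Types (P Q R : polymatroid E) (A : {set E}).

(** Bases tight on the corank of a given set, which make the corank function, and hence
    the polymatroid, recoverable from the bases alone.  The supermodular function
    [g] forgets what lies outside [A]; a base [z] of it is extended outside [A] by a value
    large enough to impose no constraint there. *)
Lemma exists_basis_corank P A :
  exists2 b, is_basis P b & \sum_(i in A) (b i)%:Z = corank P A.
Proof.
pose N : int := (P setT)%:Z.
have cN X : corank P X <= N by rewrite /corank /N; lia.
have cmono (X Y : {set E}) : X \subset Y -> corank P X <= corank P Y.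
  by rewrite -setCS => /(rk_mono P); rewrite /corank; lia.
pose g X := corank P (X :&: A).
have [||X|z [z1 z2 z3]] := @supermodular_base E g (fun=> N).
- move=> X Y; rewrite /g setIUl.
  have -> : X :&: Y :&: A = (X :&: A) :&: (Y :&: A) by rewrite setIACA setIid.
  exact: corank_super.
- by rewrite /g set0I corank0.
- have [->|/set0Pn[e eX]] := eqVneq X set0; first by rewrite /g set0I corank0 big_set0.
  apply: le_trans (cN _) _; rewrite (big_setD1 e eX) /= lerDl sumr_ge0 //.
have c_ge0 X : 0 <= corank P X by rewrite -(corank0 P); apply: cmono; exact: sub0set.
have z_ge0 i : 0 <= z i.
  by have := z2 [set i]; rewrite big_set1; apply: le_trans; exact: c_ge0.
have zA : \sum_(i in A) z i = corank P A.
  have := sumz_setUI z A (~: A); rewrite setUCr setICr big_set0 sumz_setT z3.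
  have := z2 A; rewrite /g setTI setIid.
  have : 0 <= \sum_(i in ~: A) z i by apply: sumr_ge0.
  lia.
have [X|b Bb bz] := @corank_base E P (fun i => if i \in A then z i else N).
  have [XA|/subsetPn[e eX eA]] := boolP (X \subset A).
    apply: le_trans (_ : g X <= _); first by rewrite /g (setIidPl XA).
    apply: le_trans (z2 X) _; rewrite le_eqVlt; apply/orP; left; apply/eqP.
    by apply: eq_bigr => i /(subsetP XA) ->.
  apply: le_trans (cN X) _; rewrite (big_setD1 e eX) /= (negPf eA) lerDl sumr_ge0 // => i _.
  by case: ifP.
exists b => //; apply/eqP; rewrite eq_le; have [_ ->] := (basisP P b).1 Bb.
rewrite andbT -zA; apply: ler_sum => i iA; by have := bz i; rewrite iA.
Qed.

Lemma exists_minimal_vec (S : {ffun E -> nat} -> Prop) x : S x ->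
  exists2 y, minimal_vec S y & forall i, (y i <= x i)%N.
Proof.
have [n] := ubnP (\sum_i x i); elim: n x => // n IH x xn Sx.
have [[y [Sy yx nyx]]|h] := pselect (exists y, [/\ S y, forall i, (y i <= x i)%N & y <> x]).
  have [||w mw wy] := IH y => //.
    rewrite -ltnS; apply: leq_trans xn; rewrite ltnS ltnNge; apply/negP => le.
    by apply: nyx; exact: eq_ffun_sum.
  by exists w => // i; exact: leq_trans (wy i) (yx i).
exists x => //; split=> // y Sy yx; apply: contrapT => nyx; apply: h; by exists y.
Qed.

(** The corank of [X] is the least sum over [X] of a minimal vector.  It is at least the
    maximal excess, which bounds every intersection vector, and equality comes from a basis of the
    polymatroid with rank function [intersection_rk] that is tight on [X], since an
    intersection vector, and a minimal one, lies below it. *)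
Lemma polymatroid_intersectionE a P Q A :
  polymatroid_intersection a P Q A = intersection_rk a P Q A.
Proof.
set R := polymatroid_intersection a P Q.
have hR b : is_basis R b <-> minimal_vec (basis_caps a P Q) b by exact: basis_polymatroid_intersection.
have [R0 hR0] := intersection_rk_polymatroid a P Q.
have co0 X : corank R0 X = (max_excess a P Q X)%:Z.
  rewrite /corank !hR0 /intersection_rk setCT setCK max_excess0.
  by have := max_excess_mono a P Q (subsetT X); lia.
have co X : corank R X = (max_excess a P Q X)%:Z.
  apply/eqP; rewrite eq_le; apply/andP; split.
    have [y By yX] := exists_basis_corank R0 X.
    have [|x Sx xy] := @basis_caps_below E a P Q y.
      by case/basisP: By => _ h C; have := h C; rewrite co0 -Posz_sum.
    have [w mw wx] := exists_minimal_vec Sx.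
    have /basisP[_ /(_ X)] := (hR w).2 mw => /le_trans; apply.
    rewrite -co0 -yX; apply: ler_sum => i _; rewrite lez_nat.
    exact: leq_trans (wx i) (xy i).
  have [b Bb <-] := exists_basis_corank R X.
  have [Sb _] := (hR b).1 Bb.
  by rewrite -Posz_sum lez_nat; exact: basis_caps_lower.
have := co (~: A); have := co setT.
rewrite /corank setCT setCK rk_set0 /intersection_rk.
by have := rk_mono R (subsetT A); lia.
Qed.

End IntersectionRank.

(** * Pregeometries and their rank *)

(** Closure of finite lists, satisfying the axioms of a (possibly infinite)
    matroid.  Rank is developed at this level because several closure operators
    are compared below: the same elements over different ground fields, and
    their images under maps that are not ring morphisms. *)
Record pregeometry (T : eqType) := Pregeometry {
  span :> seq T -> T -> Prop;
  span_id : forall s x, x \in s -> span s x;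
  span_trans : forall s t x, (forall y, y \in s -> span t y) -> span s x -> span t x;
  span_exchange : forall s x y, span (x :: s) y -> ~ span s y -> span (y :: s) x
}.

Section Rank.
Variables (T : eqType) (G : pregeometry T).
Implicit Types (s t u : seq T) (x y : T).

Lemma span_sub s t x : {subset s <= t} -> G s x -> G t x.
Proof. by move=> st; apply: span_trans => y /st; exact: span_id. Qed.

Lemma span_eq_mem s t x : s =i t -> G s x <-> G t x.
Proof. by move=> st; split; apply: span_sub => y; rewrite st. Qed.

(** Rank of [s] over [t].  Elements are counted from the end of the list, which
    makes additivity ([rank_cat]) immediate; that the order of the list does
    not matter is where exchange enters ([rank_swap]). *)
Fixpoint rank t s : nat :=
  if s is x :: s' then rank t s' + ~~ `[< G (s' ++ t) x >] else 0.

Lemma eq_rank t1 t2 s : (forall u x, {subset u <= s} -> G (u ++ t1) x <-> G (u ++ t2) x) ->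
  rank t1 s = rank t2 s.
Proof.
elim: s => //= x s IH h; rewrite IH => [|u y us]; last first.
  by apply: h => z /us; rewrite inE orbC => ->.
congr (_ + ~~ _); apply: asbool_equiv_eq; apply: h.
by move=> z zs; rewrite inE zs orbT.
Qed.

Lemma eq_rank_span t1 t2 s : (forall x, x \in t1 -> G t2 x) ->
  (forall x, x \in t2 -> G t1 x) -> rank t1 s = rank t2 s.
Proof.
move=> h1 h2; apply: eq_rank => u x _.
split; apply: span_trans => y; rewrite mem_cat => /orP[yu|yt].
- by apply: span_id; rewrite mem_cat yu.
- by apply: span_sub (h1 _ yt) => z zt; rewrite mem_cat zt orbT.
- by apply: span_id; rewrite mem_cat yu.
- by apply: span_sub (h2 _ yt) => z zt; rewrite mem_cat zt orbT.
Qed.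

Lemma rank_cat t s1 s2 : rank t (s1 ++ s2) = rank (s2 ++ t) s1 + rank t s2.
Proof. by elim: s1 => //= x s1 ->; rewrite catA addnAC. Qed.

(** Over the span of [s] and [t], exchange says exactly that adding [x] and then
    [y] counts as many new elements as adding [y] and then [x]. *)
Lemma rank_swap t x y s : rank t [:: x, y & s] = rank t [:: y, x & s].
Proof.
rewrite /= -!addnA; congr (_ + _).
have absorb a b : G (s ++ t) a -> G (a :: s ++ t) b -> G (s ++ t) b.
  move=> ha; apply: span_trans => z; rewrite inE => /orP[/eqP -> //|].
  exact: span_id.
have weaken a b : G (s ++ t) b -> G (a :: s ++ t) b.
  by apply: span_sub => z; rewrite inE orbC => ->.
have exch a b := @span_exchange _ G (s ++ t) a b.
case: (asboolP (G (s ++ t) x)) => a; case: (asboolP (G (s ++ t) y)) => b;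
  case: (asboolP (G (x :: s ++ t) y)) => c; case: (asboolP (G (y :: s ++ t) x)) => d //;
  exfalso; eauto.
Qed.

Lemma rank_cons_mid t s1 x s2 : rank t (s1 ++ x :: s2) = rank t (x :: s1 ++ s2).
Proof.
elim: s1 => //= y s1 IH; rewrite -[RHS]/(rank t [:: x, y & s1 ++ s2]) rank_swap /=.
rewrite IH /=; congr (_ + ~~ _); apply: asbool_equiv_eq; apply: span_eq_mem => z.
by rewrite !(inE, mem_cat); case: (z == x); rewrite /= ?orbT.
Qed.

Lemma rank_catC t s1 s2 : rank t (s1 ++ s2) = rank t (s2 ++ s1).
Proof.
elim: s1 => [|x s1 IH]; first by rewrite cats0.
rewrite rank_cons_mid /= IH; congr (_ + ~~ _); apply: asbool_equiv_eq.
by apply: span_eq_mem => z; rewrite !mem_cat [(_ \in s1) || _]orbC.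
Qed.

Lemma rank_spanned t s : (forall x, x \in s -> G t x) -> rank t s = 0.
Proof.
elim: s => //= x s IH h; rewrite IH => [|y ys]; last by apply: h; rewrite inE ys orbT.
rewrite asboolT //; apply: (@span_sub t); last by apply: h; rewrite mem_head.
by move=> z; rewrite mem_cat orbC => ->.
Qed.

(** Steinitz: appending [s] to [u] does not change the rank of [u], and by
    symmetry that rank is at least the rank of [s]. *)
Lemma leq_rank t s u : (forall x, x \in s -> G (u ++ t) x) -> rank t s <= rank t u.
Proof.
move=> h; have : rank t (s ++ u) = rank t u by rewrite rank_cat rank_spanned.
by rewrite rank_catC rank_cat => <-; exact: leq_addl.
Qed.

Lemma rank_span_eq t s u : (forall x, x \in s -> G (u ++ t) x) ->
  (forall x, x \in u -> G (s ++ t) x) -> rank t s = rank t u.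
Proof. by move=> h1 h2; apply/eqP; rewrite eqn_leq !leq_rank. Qed.

Lemma rank_eq_mem t s u : s =i u -> rank t s = rank t u.
Proof.
move=> h; apply: rank_span_eq => x xs; apply: span_id; rewrite mem_cat.
  by rewrite -h xs.
by rewrite h xs.
Qed.

Lemma leq_rank_sub t s u : {subset s <= u} -> rank t s <= rank t u.
Proof. by move=> h; apply: leq_rank => x /h xu; apply: span_id; rewrite mem_cat xu. Qed.

Lemma rank_le_base t1 t2 s : {subset t1 <= t2} -> rank t2 s <= rank t1 s.
Proof.
move=> h; elim: s => //= x s IH; apply: leq_add => //.
case: (asboolP (G (s ++ t1) x)) => [hx|_]; last by case: (~~ _).
rewrite asboolT //; apply: span_sub hx => z.
by rewrite !mem_cat => /orP[->|/h ->]; rewrite ?orbT.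
Qed.

Lemma leq_rank_cat t s u : rank t (s ++ u) <= rank t s + rank t u.
Proof.
rewrite rank_cat leq_add2r; apply: rank_le_base => z.
by rewrite mem_cat orbC => ->.
Qed.

Lemma rank_size t s : rank t s <= size s.
Proof. by elim: s => //= x s IH; rewrite -addn1; apply: leq_add => //; case: (~~ _). Qed.

Lemma rank_full t s u x : {subset s <= u} -> rank t s = rank t u -> x \in u -> G (s ++ t) x.
Proof.
move=> su e xu; have : rank t (x :: s) <= rank t s.
  rewrite e; apply: leq_rank_sub => z; rewrite inE => /orP[/eqP -> //|]; exact: su.
by rewrite /=; case: asboolP => // _; rewrite addn1 ltnn.
Qed.

Lemma rank_basis t s : exists b, [/\ {subset b <= s}, rank t b = size b, size b = rank t s &
  forall x, x \in s -> G (b ++ t) x].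
Proof.
suff [b [h1 h2 h3]] : exists b, [/\ {subset b <= s}, rank t b = size b &
    forall x, x \in s -> G (b ++ t) x].
  exists b; split=> //; rewrite -h2; apply: rank_span_eq => // x /h1 xs.
  by apply: span_id; rewrite mem_cat xs.
elim: s => [|x s [b [h1 h2 h3]]]; first by exists [::].
have [hx|hx] := pselect (G (s ++ t) x).
  exists b; split=> [z /h1 zs||z]; rewrite ?inE ?zs ?orbT //.
  case/orP => [/eqP -> {z}|/h3 //]; apply: span_trans hx => z.
  rewrite mem_cat => /orP[/h3 //|zt]; apply: span_id; rewrite mem_cat zt orbT //.
exists (x :: b); split=> [z||z]; rewrite ?inE.
- by case/orP => [-> //|/h1 ->]; rewrite orbT.
- rewrite /= h2 asboolF ?addn1 // => hb; apply: hx; apply: span_sub hb => z.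
  by rewrite !mem_cat => /orP[/h1 ->|->]; rewrite ?orbT.
- case/orP => [/eqP ->|/h3 h]; first by apply: span_id; rewrite mem_head.
  by apply: span_sub h => w /=; rewrite inE orbC => ->.
Qed.

End Rank.

(** Each element of [s] that is not counted over [t] depends on the rest, so its
    image is not counted either.  The map is arbitrary: this is applied to the
    set-theoretic maps produced by specialization. *)
Lemma rank_map (T T' : eqType) (G : pregeometry T) (H : pregeometry T') (phi : T -> T') t s :
  (forall u x, {subset u <= s} -> x \in s -> G (u ++ t) x -> H (map phi (u ++ t)) (phi x)) ->
  rank H (map phi t) (map phi s) <= rank G t s.
Proof.
elim: s => //= x s IH h; apply: leq_add.
  apply: IH => u y us ys; apply: h; last by rewrite inE ys orbT.
  by move=> z /us; rewrite inE orbC => ->.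
case: (asboolP (G (s ++ t) x)) => [hx|_]; last by case: (~~ _).
rewrite asboolT // -map_cat; apply: h => //; last exact: mem_head.
by move=> z; rewrite inE orbC => ->.
Qed.

Local Open Scope ring_scope.

(** * Algebraic closure inside a field *)

Section Fractions.
Variables (A : comNzRingType) (L : fieldType) (f : {rmorphism A -> L}).

Definition fraction_of (z : L) := exists a b, f b != 0 /\ z = f a / f b.

Lemma fraction_of_img a : fraction_of (f a).
Proof. by exists a, 1; rewrite rmorph1 oner_neq0 divr1. Qed.

Lemma fraction_subfield : is_subfield fraction_of.
Proof.
split; first by rewrite -(rmorph1 f); exact: fraction_of_img.
  move=> _ _ [a [b [b0 ->]]] [c [d [d0 ->]]].
  exists (a * d - c * b), (b * d); rewrite !rmorphB !rmorphM mulf_neq0 //; split=> //.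
  by rewrite -[- (f c / f d)]mulNr addf_div // mulNr.
move=> _ _ [a [b [b0 ->]]] [c [d [d0 ->]]].
have [c0|c0] := eqVneq (f c) 0.
  exists 0, 1; rewrite rmorph0 rmorph1 oner_neq0; split=> //.
  by rewrite c0 !mul0r invr0 mulr0.
exists (a * d), (b * c); rewrite !rmorphM mulf_neq0 //; split=> //.
by rewrite invf_div mulf_div.
Qed.

(** The factor [c] is kept as an element of the ring, so that [q] has
    coefficients in the ring itself. *)
Lemma clear_denominators (p : {poly L}) :
  (forall i, fraction_of p`_i) ->
  exists (q : {poly A}) c, f c != 0 /\ map_poly f q = f c *: p.
Proof.
elim/poly_ind: p => [|p k IH] hp.
  by exists 0, 1; rewrite rmorph1 oner_neq0 rmorph0 scaler0.
have [|q [c [c0 hq]]] := IH.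
  by move=> i; have := hp i.+1; rewrite coefD coefMX coefC addr0.
have [a [b [b0 hk]]] := hp 0%N; rewrite coefD coefMX coefC /= add0r in hk.
exists (b *: q * 'X + (c * a)%:P), (c * b); rewrite rmorphM mulf_neq0 //; split=> //.
rewrite rmorphD /= rmorphM /= map_polyX map_polyC map_polyZ hq /= scalerDr -!mul_polyC.
rewrite hk rmorphM !mulrA -!polyCM; congr (_%:P * _ * _ + _); first by rewrite mulrC.
by congr (_%:P); rewrite -!mulrA; congr (_ * _); rewrite mulrCA mulfV // mulr1.
Qed.

(** Algebraicity witnessed by a polynomial over the ring [A] rather than over
    the fractions of its image.  Such witnesses can be transported along any
    other morphism out of [A], which is what specialization needs. *)
Definition algebraic_via (z : L) :=
  exists q : {poly A}, map_poly f q != 0 /\ root (map_poly f q) z.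

Lemma algebraic_over_via (F : L -> Prop) z :
  (forall x, F x -> fraction_of x) -> algebraic_over F z -> algebraic_via z.
Proof.
move=> Ff [p [p0 hp pz]]; have [|q [c [c0 hq]]] := clear_denominators (p := p).
  by move=> i; exact: Ff.
by exists q; rewrite hq scaler_eq0 (negPf c0) rootZ.
Qed.

Lemma algebraic_via_over (F : L -> Prop) z :
  (forall a, F (f a)) -> algebraic_via z -> algebraic_over F z.
Proof.
move=> Ff [q [q0 qz]]; exists (map_poly f q).
by split=> // i; rewrite coef_map; exact: Ff.
Qed.

End Fractions.

Section Subfields.
Variables (L : fieldType) (F : L -> Prop) (sF : is_subfield F).

Lemma subfield1 : F 1. Proof. by case: sF. Qed.
Lemma subfieldB x y : F x -> F y -> F (x - y). Proof. by case: sF => _ + _; apply. Qed.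
Lemma subfield_div x y : F x -> F y -> F (x / y). Proof. by case: sF => _ _; apply. Qed.
Lemma subfield0 : F 0.
Proof. by rewrite -(subrr 1); apply: subfieldB; exact: subfield1. Qed.
Lemma subfieldD x y : F x -> F y -> F (x + y).
Proof.
move=> Fx Fy; rewrite -[y]opprK -[- y]sub0r; apply: subfieldB => //.
by apply: subfieldB => //; exact: subfield0.
Qed.
Lemma subfieldM x y : F x -> F y -> F (x * y).
Proof.
move=> Fx Fy; rewrite -[y]invrK -[y^-1]mul1r; apply: subfield_div => //.
by apply: subfield_div => //; exact: subfield1.
Qed.
Lemma subfieldX x n : F x -> F (x ^+ n).
Proof.
by move=> Fx; elim: n => [|n IH]; rewrite ?expr0 ?exprS; [exact: subfield1|exact: subfieldM].
Qed.

Lemma subfield_horner (p : {poly L}) z : (forall i, F p`_i) -> F z -> F p.[z].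
Proof.
move=> Fp Fz; rewrite horner_coef; elim/big_ind: _ => [||i _]; first exact: subfield0.
  exact: subfieldD.
by apply: subfieldM => //; exact: subfieldX.
Qed.

(** The proof argument is the key on which the closure instance below is found. *)
Definition subfield_pred (_ : is_subfield F) : {pred L} := fun x => `[< F x >].

Lemma subfield_divring : divring_closed (subfield_pred sF).
Proof.
split; first exact/asboolP/subfield1.
  by move=> x y /asboolP Fx /asboolP Fy; exact/asboolP/subfieldB.
by move=> x y /asboolP Fx /asboolP Fy; exact/asboolP/subfield_div.
Qed.
End Subfields.

HB.instance Definition _ (L : fieldType) (F : L -> Prop) (sF : is_subfield F) :=
  GRing.isDivringClosed.Build L (subfield_pred sF) (subfield_divring sF).

(** A subfield as a field in its own right, so that the theory of elements
    algebraic over a field applies to it. *)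
Section SubfieldType.
Variables (L : fieldType) (F : L -> Prop) (sF : is_subfield F).
Record subfield_type := SubfieldType {
  subfield_val : L; _ : subfield_val \in subfield_pred sF }.
HB.instance Definition _ := [isSub for subfield_val].
HB.instance Definition _ := [Choice of subfield_type by <:].
HB.instance Definition _ := [SubChoice_isSubComUnitRing of subfield_type by <:].
HB.instance Definition _ := [SubComUnitRing_isSubIntegralDomain of subfield_type by <:].
HB.instance Definition _ := [SubIntegralDomain_isSubField of subfield_type by <:].
End SubfieldType.

Section SubfieldVal.
Variables (L : fieldType) (F : L -> Prop) (sF : is_subfield F).
Definition sfval : {rmorphism subfield_type sF -> L} := \val.
Lemma sfvalP a : F (sfval a).
Proof. by case: a => x /= /asboolP. Qed.
Lemma sfval_lift x : F x -> exists a, sfval a = x.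
Proof. by move=> /asboolP Fx; exists (SubfieldType Fx). Qed.

Lemma algebraic_overP z : algebraic_over F z <-> algebraicOver sfval z.
Proof.
split=> [h|[p p0 pz]].
  have [|q [q0 qz]] := algebraic_over_via (f := sfval) _ h.
    by move=> x /sfval_lift [a <-]; exact: fraction_of_img.
  by exists q => //; rewrite map_poly_eq0 in q0.
by apply: algebraic_via_over (sfvalP) _; exists p; rewrite map_poly_eq0.
Qed.

Lemma algebraic_over_subfield : is_subfield (algebraic_over F).
Proof.
split.
- exact/algebraic_overP/algebraic1.
- by move=> x y /algebraic_overP ? /algebraic_overP ?; exact/algebraic_overP/algebraic_sub.
- by move=> x y /algebraic_overP ? /algebraic_overP ?; exact/algebraic_overP/algebraic_div.
Qed.

(** The coefficients of a monic relation for [z] are integral over [F], and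
    a root of a monic polynomial with integral coefficients is integral. *)
Lemma algebraic_over_trans z :
  algebraic_over (algebraic_over F) z -> algebraic_over F z.
Proof.
move=> [p [p0 hp pz]]; apply/algebraic_overP/integral_algebraic.
have lp : lead_coef p != 0 by rewrite lead_coef_eq0.
apply: (@integral_root_monic _ _ _ z ((lead_coef p)^-1 *: p)).
- by rewrite monicE lead_coefZ mulVf.
- by rewrite rootZ ?invr_eq0.
- apply/integral_poly => i; rewrite coefZ mulrC.
  by apply: integral_div; apply/integral_algebraic/algebraic_overP; exact: hp.
Qed.

End SubfieldVal.

Lemma algebraic_over_sub (L : fieldType) (F G : L -> Prop) z :
  (forall x, F x -> G x) -> algebraic_over F z -> algebraic_over G z.
Proof.
by move=> FG [p [p0 hp pz]]; exists p; split=> // i; exact: FG.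
Qed.

Lemma algebraic_over_id (L : fieldType) (F : L -> Prop) (sF : is_subfield F) z :
  F z -> algebraic_over F z.
Proof. by move=> /(sfval_lift sF)[a <-]; exact/algebraic_overP/algebraic_id. Qed.

(** Substituting [z] for the outer variable of a bivariate polynomial leaves a
    polynomial in the inner one; this reads off its coefficients. *)
Lemma coef_horner_polyC (F L : comNzRingType) (g : {rmorphism F -> L})
    (q : {poly {poly F}}) z j :
  (map_poly (map_poly g) q).[z%:P]`_j = (map_poly g (map_poly (coefp j) q)).[z].
Proof.
rewrite (horner_coef_wide z%:P (n := size q)) ?coef_sum; last exact: size_poly.
rewrite (horner_coef_wide z (n := size q)); last first.
  exact: leq_trans (size_poly _ _) (size_poly _ _).
apply: eq_bigr => i _; rewrite -rmorphXn /= coefMC; congr (_ * _).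
by rewrite !coef_map coef_map_id0 ?coef0.
Qed.

Section Closure.
Variables (K L : fieldType) (iota : {rmorphism K -> L}).
Implicit Types S T : L -> Prop.

Lemma adjoin_field S : intermediate_field iota (adjoin iota S).
Proof.
split; last by move=> k F [_ hk] _; exact: hk.
split=> [F [[h _ _] _] _ //|x y hx hy F hF SF|x y hx hy F hF SF].
  by have [[_ h _] _] := hF; apply: h; [exact: hx|exact: hy].
by have [[_ _ h] _] := hF; apply: h; [exact: hx|exact: hy].
Qed.

Lemma adjoin_subfield S : is_subfield (adjoin iota S).
Proof. by have [] := adjoin_field S. Qed.

Lemma adjoin_base S k : adjoin iota S (iota k).
Proof. by have [_] := adjoin_field S; apply. Qed.

Lemma adjoin_id S x : S x -> adjoin iota S x.
Proof. by move=> Sx F _; apply. Qed.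

Lemma adjoin_sub S T z :
  (forall x, S x -> adjoin iota T x) -> adjoin iota S z -> adjoin iota T z.
Proof. by move=> ST; apply; first exact: adjoin_field. Qed.

Definition acl S z := algebraic_over (adjoin iota S) z.

Lemma acl_field S : intermediate_field iota (acl S).
Proof.
split; first exact: algebraic_over_subfield (adjoin_subfield S).
move=> k; apply: algebraic_over_id (adjoin_subfield S) _ _; exact: adjoin_base.
Qed.

Lemma acl_adjoin S x : adjoin iota S x -> acl S x.
Proof. by move=> Sx; apply: algebraic_over_id (adjoin_subfield S) _ _. Qed.

Lemma acl_id S x : S x -> acl S x.
Proof. by move=> Sx; apply: acl_adjoin; exact: adjoin_id. Qed.

Lemma acl_trans S T z : (forall x, S x -> acl T x) -> acl S z -> acl T z.
Proof.
move=> ST Sz; apply: algebraic_over_trans (adjoin_subfield T) _ _.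
by apply: algebraic_over_sub Sz => x; apply => //; exact: acl_field.
Qed.

Lemma acl_closed S z : algebraic_over (acl S) z -> acl S z.
Proof. exact: algebraic_over_trans (adjoin_subfield S) z. Qed.

Lemma acl_sub S T z : (forall x, S x -> T x) -> acl S z -> acl T z.
Proof. by move=> ST; apply: acl_trans => x /ST; exact: acl_id. Qed.

(** A relation for [z] over [S] and [y] is, after clearing denominators, a
    bivariate polynomial over the field generated by [S] that vanishes at
    [(y, z)].  Read as a polynomial in [y] with coefficients depending on [z],
    it stays non-zero because [z] is transcendental over [S]. *)
Lemma acl_exchange S y z :
  acl (fun x => x = y \/ S x) z -> ~ acl S z -> acl (fun x => x = z \/ S x) y.
Proof.
set sF := adjoin_subfield S; pose f := horner_morph (fun a => mulrC y (sfval sF a)).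
move=> hz nz.
have [|q [q0 qz]] := algebraic_over_via (f := f) _ hz.
  move=> x; apply.
    split; first exact: fraction_subfield.
    move=> k; have [a <-] := sfval_lift sF (adjoin_base (S := S) k).
    have -> : sfval sF a = f (a%:P) by rewrite /f /horner_morph map_polyC hornerC.
    exact: fraction_of_img.
  move=> {}x [->|Sx].
    have fX : f 'X = y by rewrite /f /horner_morph map_polyX hornerX.
    by rewrite -[X in fraction_of _ X]fX; exact: fraction_of_img.
  have [a <-] := sfval_lift sF (adjoin_id Sx).
  have -> : sfval sF a = f (a%:P) by rewrite /f /horner_morph map_polyC hornerC.
  exact: fraction_of_img.
pose r := (map_poly (map_poly (sfval sF)) q).[z%:P].
have coef_r := coef_horner_polyC (sfval sF) q z.
exists r; split.
(* The column of [q] through a non-zero coefficient of its leading one is a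
   non-zero polynomial over [S], so it does not vanish at [z]. *)
- have [j hj] : exists j, map_poly (coefp j) q != 0.
    have q1 : lead_coef q != 0.
      by rewrite lead_coef_eq0; apply: contraNneq q0 => ->; rewrite rmorph0.
    exists (size (lead_coef q)).-1; apply/eqP => /polyP /(_ (size q).-1).
    rewrite coef_map coef0 /= => /eqP; rewrite -lead_coefE; apply/negP.
    by rewrite -lead_coefE lead_coef_eq0.
  apply: contra_notN nz => /eqP r0; apply/(algebraic_overP sF).
  by exists (map_poly (coefp j) q) => //; rewrite /root -coef_r -/r r0 coef0.
- move=> i; rewrite coef_r; apply: (subfield_horner (adjoin_subfield _)).
    move=> k; rewrite coef_map; apply: (@adjoin_sub S); last exact: sfvalP.
    by move=> x Sx; apply: adjoin_id; right.
  by apply: adjoin_id; left.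
- have -> : root r y = root (map_poly f q) z; last by [].
  rewrite /root -[in RHS](hornerC z y) /r -!/(horner_eval y _) -horner_map /=.
  rewrite -map_poly_comp.
  by congr (_.[_] == 0); apply: eq_map_poly.
Qed.

End Closure.

(** * Transcendence degree as a rank *)

Section AlgebraicPregeometry.
Variables (K L : fieldType) (iota : {rmorphism K -> L}).

Definition algebraic_span (s : seq L) : L -> Prop := acl iota (fun x => x \in s).

Definition algebraic_pregeometry : pregeometry L.
Proof.
apply: (@Pregeometry _ algebraic_span) => [s x xs|s t x st|s x y].
- exact: acl_id.
- exact: acl_trans.
- move=> h ny; apply: acl_sub (acl_exchange (y := x) _ ny) => [z|].
    by rewrite inE => -[->|->]; rewrite ?eqxx ?orbT.
  by apply: acl_sub h => z; rewrite inE => /orP[/eqP|]; [left|right].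
Defined.

Lemma acl_codom d (x : 'I_d -> L) z :
  acl iota (fun y => exists i, y = x i) z <-> algebraic_pregeometry (codom x) z.
Proof.
split; apply: acl_sub => y; first by move=> [i ->]; exact: codom_f.
by case/codomP => i ->; exists i.
Qed.

End AlgebraicPregeometry.

Lemma rmorph_inj0 (R S : nzRingType) (f : {rmorphism R -> S}) :
  (forall a, f a = 0 -> a = 0) -> injective f.
Proof. by move=> h; apply: raddf_inj => a; exact: h. Qed.

Lemma mpoly_rmorph_ext (R S : comNzRingType) (d : nat) (f g : {rmorphism {mpoly R[d]} -> S}) :
  (forall c, f c%:MP = g c%:MP) -> (forall i, f 'X_i = g 'X_i) -> f =1 g.
Proof.
move=> fgC fgX p; rewrite [p]mpolyE !rmorph_sum /=; apply: eq_bigr => m _.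
rewrite -mul_mpolyC !rmorphM fgC; congr (_ * _).
by rewrite mpolyXE_id !rmorph_prod /=; apply: eq_bigr => i _; rewrite !rmorphXn /= fgX.
Qed.

Section SplitLastVariable.
Variables (R : comNzRingType) (d : nat).
Local Notation wid := (widen_ord (leqnSn d)).

Lemma muniX_widen i : muni ('X_(wid i) : {mpoly R[d.+1]}) = ('X_i)%:P.
Proof.
rewrite muniE msuppX big_seq1 mcoeffX eqxx scale1r mnm1E.
have -> : (wid i == ord_max) = false by apply/negbTE; rewrite -val_eqE /= ltn_eqF.
rewrite expr0 alg_polyC; congr (_%:P); congr 'X_[_]; apply/mnmP => j.
by rewrite mnmE !mnm1E -val_eqE.
Qed.

Lemma muniX_max : muni ('X_ord_max : {mpoly R[d.+1]}) = 'X.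
Proof.
rewrite muniE msuppX big_seq1 mcoeffX eqxx scale1r mnm1E eqxx expr1.
set m := [multinom _ | _ < _]; have -> : m = 0%MM; last by rewrite mpolyX0 scale1r.
apply/mnmP => j; rewrite mnmE mnm1E mnm0E -val_eqE /=.
by rewrite gtn_eqF.
Qed.

Lemma muni_widen (p : {mpoly R[d]}) : muni (mwiden p) = p%:P.
Proof.
apply: (mpoly_rmorph_ext (f := @muni d R \o @mwiden d R)
  (g := @polyC {mpoly R[d]})) => [c|i] /=.
  by rewrite mwidenC muniC.
by rewrite mwidenX mnmwiden1 muniX_widen.
Qed.

Lemma mmultiE (q : {poly {mpoly R[d]}}) : mmulti q = (map_poly (@mwiden d R) q).['X_ord_max].
Proof.
rewrite (horner_coef_wide _ (n := size q)); last exact: size_poly.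
by apply: eq_bigr => i _; rewrite coef_map.
Qed.

Lemma mmultiK : cancel (@mmulti d R) (@muni d R).
Proof.
move=> q; rewrite rmorph_sum /= -[RHS]coefK poly_def; apply: eq_bigr => i _.
by rewrite rmorphM rmorphXn /= muniX_max muni_widen mul_polyC.
Qed.

Lemma muniK : cancel (@muni d R) (@mmulti d R).
Proof.
move=> p; rewrite mmultiE -/(horner_eval _ _).
apply: (mpoly_rmorph_ext (f := horner_eval 'X_ord_max \o map_poly (@mwiden d R) \o @muni d R)
  (g := idfun)) => [c|i] /=.
  by rewrite muniC map_polyC /= mwidenC /horner_eval hornerC.
case: (unliftP ord_max i) => [j ->|->]; last by rewrite muniX_max map_polyX /horner_eval hornerX.
have -> : lift ord_max j = wid j by apply/val_inj; rewrite /= /bump leqNgt ltn_ord.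
by rewrite muniX_widen map_polyC /= mwidenX mnmwiden1 /horner_eval hornerC.
Qed.

End SplitLastVariable.

Section AlgIndependence.
Variables (K L : fieldType) (iota : {rmorphism K -> L}).
Local Notation G := (algebraic_pregeometry iota).

Section Eval.
Variables (d : nat) (x : 'I_d -> L).

Definition eval_at : {rmorphism {mpoly K[d]} -> L} := mmap iota x.

Lemma eval_atE p : eval_at p = (map_mpoly iota p).@[x].
Proof.
rewrite /eval_at /= (mmapE _ (leqnn _)) (map_mpolyE iota (leqnn _)).
rewrite raddf_sum /=; apply: eq_bigr => m _.
by rewrite mevalZ mevalX.
Qed.

Lemma eval_atC c : eval_at c%:MP = iota c.
Proof. exact: mmapC. Qed.

Lemma eval_atX i : eval_at 'X_i = x i.
Proof. by rewrite /eval_at /= mmapX mmap1U. Qed.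

Lemma adjoin_fraction_of z : adjoin iota (fun y => exists i, y = x i) z ->
  fraction_of eval_at z.
Proof.
apply; last by move=> _ [i ->]; rewrite -eval_atX; exact: fraction_of_img.
split; first exact: fraction_subfield.
by move=> k; rewrite -eval_atC; exact: fraction_of_img.
Qed.

Lemma eval_at_adjoin p : adjoin iota (fun y => exists i, y = x i) (eval_at p).
Proof.
have sF := adjoin_subfield iota (fun y => exists i, y = x i).
rewrite /eval_at /= (mmapE _ (leqnn _)).
elim/big_ind: _ => [||m _]; [exact: subfield0 | exact: subfieldD |].
apply: (subfieldM sF); first exact: adjoin_base.
rewrite /mmap1; elim/big_ind: _ => [||i _]; [exact: subfield1 | exact: subfieldM |].
by apply: (subfieldX sF); apply: adjoin_id; exists i.
Qed.

Lemma span_codomP z : G (codom x) z <-> algebraic_via eval_at z.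
Proof.
split=> [/acl_codom h|h]; first exact: algebraic_over_via adjoin_fraction_of h.
by apply/acl_codom; exact: algebraic_via_over eval_at_adjoin h.
Qed.

End Eval.

Lemma alg_independentP d (x : 'I_d -> L) :
  alg_independent iota x <-> injective (eval_at x).
Proof.
split=> [h|h p]; last by rewrite -eval_atE => hp; apply: h; rewrite hp rmorph0.
by apply: rmorph_inj0 => p hp; apply: h; rewrite -eval_atE.
Qed.

Section EvalS.
Variables (d : nat) (x : 'I_d.+1 -> L).
Let y (i : 'I_d) := x (widen_ord (leqnSn d) i).

Lemma eval_at_mmulti q : eval_at x (mmulti q) = (map_poly (eval_at y) q).[x ord_max].
Proof.
rewrite mmultiE -horner_map /= eval_atX -map_poly_comp; congr (_.[_]).
apply: eq_map_poly.
apply: (mpoly_rmorph_ext (f := eval_at x \o @mwiden d K) (g := eval_at y)) => [c|i] /=.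
  by rewrite mwidenC !eval_atC.
by rewrite mwidenX mnmwiden1 !eval_atX.
Qed.

(** A polynomial in [d.+1] variables is a univariate polynomial over those in
    the first [d]; a relation either has all its coefficients vanishing, or makes
    the last element algebraic over the others. *)
Lemma alg_independentS : alg_independent iota x <->
  alg_independent iota y /\ ~ G (codom y) (x ord_max).
Proof.
split=> [/alg_independentP h|[/alg_independentP h1 h2]]; last first.
  apply/alg_independentP; apply: rmorph_inj0 => p; rewrite -[p]muniK eval_at_mmulti => hp.
  suff -> : muni p = 0 by rewrite mmultiE rmorph0 horner0.
  apply: contra_notP h2 => q0; apply/span_codomP; exists (muni p); split; last exact/eqP.
  apply/eqP => q1; apply: q0; apply: (map_inj_poly h1); rewrite ?rmorph0 //.
split=> [|/span_codomP[q [q0 /eqP]]].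
  apply/alg_independentP; apply: rmorph_inj0 => p hp; apply: (@inj_mwiden d K).
  apply: h; rewrite raddf0 rmorph0 -[mwiden p]muniK muni_widen eval_at_mmulti.
  by rewrite map_polyC hornerC.
rewrite -eval_at_mmulti => hq; case/eqP: q0.
suff -> : q = 0 by rewrite rmorph0.
rewrite -[q]mmultiK; suff -> : mmulti q = 0 by rewrite raddf0.
by apply: h; rewrite rmorph0.
Qed.

End EvalS.

Lemma alg_independent_rank d (x : 'I_d -> L) :
  alg_independent iota x <-> rank G [::] (codom x) = d.
Proof.
elim: d x => [|d IH] x.
  split=> [_|_ p hp]; first by rewrite /codom /image_mem enum_ord0.
  have pE : p = (p@_0)%:MP.
    apply/mpolyP => m; rewrite mcoeffC; have -> : m = 0%MM by apply/mnmP => -[].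
    by rewrite eqxx mulr1.
  move: hp; rewrite pE -eval_atE eval_atC => /eqP.
  by rewrite fmorph_eq0 => /eqP ->.
have e : codom x =i x ord_max :: codom (fun i : 'I_d => x (widen_ord (leqnSn d) i)).
  move=> z; rewrite inE; apply/codomP/idP => [[i ->]|].
    case: (unliftP ord_max i) => [j ->|->]; last by rewrite eqxx.
    by apply/orP; right; apply/codomP; exists j; congr x; apply/val_inj; rewrite /= /bump leqNgt ltn_ord.
  by case/orP => [/eqP ->|/codomP[i ->]]; eexists.
rewrite (rank_eq_mem _ _ e) /= cats0 alg_independentS IH.
have := rank_size G [::] (codom (fun i : 'I_d => x (widen_ord (leqnSn d) i))).
rewrite size_codom card_ord => hr.
split=> [[-> h]|]; first by rewrite asboolF // addn1.
case: asboolP => h /=; last by rewrite addn1 => -[->].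
by rewrite addn0 => E; rewrite E ltnn in hr.
Qed.

End AlgIndependence.

Section TranscendenceDegree.
Variables (K L : fieldType) (iota : {rmorphism K -> L}).
Local Notation G := (algebraic_pregeometry iota).

Lemma codom_nth (s : seq L) : codom (fun i : 'I_(size s) => nth 0 s i) = s.
Proof.
rewrite /codom /image_mem -[RHS](mkseq_nth 0) /mkseq -val_enum_ord -map_comp.
by rewrite [enum _](eq_enum (_ : _ =i predT)).
Qed.

(** The set [S] may be infinite, so its transcendence degree is read off a finite
    list over which it is algebraic. *)
Lemma trdeg_eq_rank (S : L -> Prop) (s : seq L) d :
  (forall x, x \in s -> adjoin iota S x) -> (forall x, S x -> G s x) ->
  trdeg_eq iota (adjoin iota S) d <-> rank G [::] s = d.
Proof.
move=> sS Ss; have aS z : adjoin iota S z -> G s z.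
  by apply; [exact: acl_field | exact: Ss].
split=> [[x [xS /alg_independent_rank xi xs]]|].
  rewrite -xi; apply: rank_span_eq => z; rewrite cats0.
    by move=> /sS /xs; exact: (acl_codom iota x z).1.
  by case/codomP => i ->; apply: aS.
have [b [bs br <- sb]] := rank_basis G [::] s => <-.
have cb := codom_nth b.
exists (fun i => nth 0 b i); split=> [i||z /aS hz].
- by apply: sS; apply: bs; exact: mem_nth.
- by apply/alg_independent_rank; rewrite cb.
- apply/acl_codom; rewrite cb; apply: span_trans hz => y /sb.
  by rewrite cats0.
Qed.

End TranscendenceDegree.

Section Realization.
Variables (K : fieldType) (E : finType).

Definition union_seq (T : eqType) (z : E -> seq T) (S : {set E}) : seq T :=
  flatten [seq z i | i in S].

Lemma mem_union_seq (T : eqType) (z : E -> seq T) (S : {set E}) x :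
  reflect (exists2 i, i \in S & x \in z i) (x \in union_seq z S).
Proof. exact: flatten_imageP. Qed.

Lemma union_seq_sub (T : eqType) (z : E -> seq T) (A B : {set E}) :
  A \subset B -> {subset union_seq z A <= union_seq z B}.
Proof.
by move=> /subsetP AB x /mem_union_seq[i iA xi]; apply/mem_union_seq; exists i => //; exact: AB.
Qed.

(** An algebraic representation with the fields replaced by finite lists of
    elements.  Any function on subsets is allowed, so that the intermediate rank
    functions need not be packaged as polymatroids. *)
Definition realizable (r : {set E} -> nat) : Prop :=
  exists (L : fieldType) (iota : {rmorphism K -> L}) (z : E -> seq L),
    forall S, rank (algebraic_pregeometry iota) [::] (union_seq z S) = r S.

(** Each field [Li i] has finite transcendence degree, so a transcendence basis of
    it can replace it in every span. *)
Lemma algebraic_realizable (P : polymatroid E) : algebraic_polymatroid K P -> realizable P.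
Proof.
move=> [L [iota [Li [hL hP]]]].
have /choice[z hz] : forall i, exists s : seq L, (forall x, x \in s -> Li i x) /\
    forall x, Li i x -> algebraic_pregeometry iota s x.
  move=> i; have [x [x1 _ x3]] := hP [set i]; exists (codom x); split=> [y|y Ly].
    case/codomP => k ->; apply: (x1 k); first exact: hL.
    by move=> w [j]; rewrite inE => /eqP ->.
  by apply: (acl_codom iota x y).1; apply: x3; apply: adjoin_id; exists i; rewrite ?inE.
exists L, iota, z => S; apply/trdeg_eq_rank; last exact: hP.
  by move=> x /mem_union_seq[i iS xi]; apply: adjoin_id; exists i => //; exact: (hz i).1.
move=> x [i iS /(hz i).2]; apply: span_sub => y yi.
by apply/mem_union_seq; exists i.
Qed.

Lemma realizable_algebraic (P : polymatroid E) : realizable P -> algebraic_polymatroid K P.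
Proof.
move=> [L [iota [z hz]]]; exists L, iota, (fun i => adjoin iota (fun x => x \in z i)).
split=> [i|S]; first exact: adjoin_field.
apply/(trdeg_eq_rank (s := union_seq z S)) => // x.
  by case/mem_union_seq => i iS xi; apply: adjoin_id; exists i => //; exact: adjoin_id.
move=> [i iS /acl_adjoin]; apply: acl_sub => y yi.
by apply/mem_union_seq; exists i.
Qed.

Lemma eq_realizable r r' : r =1 r' -> realizable r -> realizable r'.
Proof. by move=> e [L [iota [z hz]]]; exists L, iota, z => S; rewrite hz. Qed.

End Realization.

(** * Extension of specializations *)

Lemma exists_root_extension (M : fieldType) (p : {poly M}) : (1 < size p)%N ->
  exists (M' : fieldType) (j : {rmorphism M -> M'}) (y : M'), root (map_poly j p) y.
Proof.
have [n] := ubnP (size p); elim: n p => // n IH p pn p1.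
have [/irredp_FAdjoin[L _ [y py _]]|] := pselect (irreducible_poly p).
  by exists L, (GRing.in_alg L), y.
move=> red; have [q [q1 qp nq]] : exists q : {poly M}, [/\ size q != 1%N, q %| p & ~~ (q %= p)].
  apply: contra_notP red => h; split=> // q q1 qp.
  by apply: contra_notT h => nq; exists q.
have p0 : p != 0 by rewrite -size_poly_gt0 ltnW.
have q0 : q != 0 by apply: contraNneq p0 => q0; move: qp; rewrite q0 dvd0p.
have sq : (size q < size p)%N by rewrite ltn_neqAle dvdp_size_eqp // nq dvdp_leq.
have [||M' [j [y hy]]] := IH q; first exact: leq_trans sq _.
  by rewrite ltn_neqAle eq_sym q1 size_poly_gt0.
by exists M', j, y; apply: root_dvdp hy; rewrite dvdp_map.
Qed.

Section ExtendOne.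
Variables (A : comNzRingType) (F M : fieldType).
Variables (f : {rmorphism A -> F}) (g : {rmorphism A -> M}).
Hypothesis kerfg : forall a, f a = 0 -> g a = 0.
Variable y : F.

(** Chevalley's argument.  The polynomial [q] says that [y] is forced to be
    infinite after specialization (its relation reduces to a non-zero constant),
    while [m], whose leading coefficient survives, forces it to be finite.
    Playing the two relations against each other lowers one of the degrees. *)
Lemma no_unit_relation n d (q m : {poly A}) :
  (size q <= n.+1)%N -> (size m <= d.+1)%N ->
  (map_poly f q).[y] = 0 -> (map_poly f m).[y] = 0 ->
  g q`_0 != 0 -> (forall i, g q`_i.+1 = 0) -> g m`_d != 0 -> False.
Proof.
have [k] := ubnP (n + d); elim: k n d q m => // k IH n d q m nd sq sm qy my q0 qi md.
have cst (p : {poly A}) : (size p <= 1)%N -> (map_poly f p).[y] = 0 -> g p`_0 = 0.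
  by move=> /size1_polyC ->; rewrite map_polyC hornerC coefC => /kerfg.
have f0 : y != 0.
  apply: contraNneq q0 => y0; apply/eqP/kerfg.
  by move: qy; rewrite y0 horner_coef0 coef_map.
case: d => [|d] in nd sm md *; first by rewrite cst ?eqxx // in md.
case: n => [|n] in nd sq *; first by rewrite cst ?eqxx // in q0.
(* If [q] has the larger degree, [m] cancels its leading term; the constant
   term changes only by an element killed by [g]. *)
have [dn|nd'] := leqP d n.
  apply: (IH n d.+1 (m`_d.+1 *: q - (q`_n.+1 *: 'X^(n - d) * m)) m) => //.
  - apply/leq_sizeP => i ni; rewrite coefB coefZ -scalerAl coefZ coefXnM.
    rewrite ltnNge (_ : n - d <= i)%N /=; last lia.
    move: ni; rewrite leq_eqVlt => /orP[/eqP <-|ni].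
      rewrite (_ : n.+1 - (n - d) = d.+1)%N; last lia.
      by rewrite mulrC subrr.
    rewrite [q`_i]nth_default; last exact: leq_trans sq ni.
    rewrite mulr0 [m`__]nth_default ?mulr0 ?subr0 //; apply: leq_trans sm _; clear -ni dn; lia.
  - rewrite rmorphB rmorphM /= !map_polyZ /= hornerD hornerN hornerM !hornerZ qy my.
    by rewrite !mulr0 subrr.
  - rewrite coefB coefZ -scalerAl coefZ rmorphB !rmorphM qi mul0r subr0.
    by rewrite mulf_neq0.
  - by move=> i; rewrite coefB coefZ -scalerAl coefZ rmorphB !rmorphM !qi mulr0 mul0r subr0.
(* Otherwise [q] cancels the constant term of [m], and a factor [y] divides out. *)
pose w := q`_0 *: m - m`_0 *: q.
have wE : w = \poly_(i < d.+1) w`_i.+1 * 'X.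
  apply/polyP => -[|i]; rewrite coefMX /=.
    by rewrite /w coefB !coefZ mulrC subrr.
  rewrite coef_poly; case: ltnP => // hi; rewrite /w coefB !coefZ.
  rewrite [m`_i.+1]nth_default; last by apply: leq_trans sm _; rewrite ltnS.
  by rewrite [q`_i.+1]nth_default ?mulr0 ?subrr //; apply: leq_trans sq _; lia.
apply: (IH n.+1 d q (\poly_(i < d.+1) w`_i.+1)) => //.
- by move: nd; clear; lia.
- apply: (mulIf f0); rewrite mul0r -[X in _ * X]hornerX -(map_polyX f).
  rewrite -hornerM -rmorphM /= -wE /w rmorphB /= !map_polyZ /= hornerD hornerN !hornerZ.
  by rewrite qy my !mulr0 subrr.
rewrite coef_poly ltnSn /w coefB !coefZ [q`_d.+1]nth_default; last by apply: leq_trans sq _; lia.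
by rewrite mulr0 subr0 rmorphM mulf_neq0.
Qed.

(** Let [p0] be of least degree among the non-zero polynomials that arise by
    applying [g] to relations satisfied by [y].  Pseudo-division in [A] shows that [p0]
    divides all of them, so any root of [p0] is an admissible image of [y]; and [p0] is
    not constant by [no_unit_relation]. *)
Lemma extend_specialization (m : {poly A}) : root (map_poly f m) y -> g (lead_coef m) != 0 ->
  exists (M' : fieldType) (j : {rmorphism M -> M'}) (y' : M'),
    forall q, (map_poly f q).[y] = 0 -> (map_poly (j \o g) q).[y'] = 0.
Proof.
move=> /eqP my gm.
have m0 : map_poly g m != 0.
  by apply: contraNneq gm => m0; rewrite lead_coefE -coef_map m0 coef0.
pose R n := `[< exists q, [/\ (map_poly f q).[y] = 0, map_poly g q != 0 & size (map_poly g q) = n] >].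
have [|n /asboolP[q0 [q0y gq0 sq0]] minn] := @ex_minnP R.
  by exists (size (map_poly g m)); apply/asboolP; exists m.
set p0 := map_poly g q0 in gq0 sq0.
have min q : (map_poly f q).[y] = 0 -> (size (map_poly g q) < n)%N -> map_poly g q = 0.
  move=> qy sq; apply/eqP/negPn/negP => gq.
  by move: (minn (size (map_poly g q))); rewrite leqNgt sq => /(_ _)/notF; apply; apply/asboolP; exists q.
have p01 : (1 < size p0)%N.
  rewrite ltnNge; apply/negP => /size1_polyC p0C.
  apply: (@no_unit_relation (size q0) (size m).-1 q0 m) => //.
  - by rewrite -ltnS; case: (size m).
  - by rewrite -coef_map -/p0; apply: contraNneq gq0 => h; rewrite p0C h.
  - by move=> i; rewrite -coef_map -/p0 p0C coefC.
have dvd q : (map_poly f q).[y] = 0 -> p0 %| map_poly g q.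
  have [k] := ubnP (size (map_poly g q)); elim: k q => // k IH q qk qy.
  have [lt|ge] := ltnP (size (map_poly g q)) n; first by rewrite min ?dvdp0.
  set e := size (map_poly g q) in qk ge.
  pose c := q0`_n.-1; pose a := q`_e.-1.
  have gc : g c != 0 by rewrite /c -coef_map -/p0 -sq0 -lead_coefE lead_coef_eq0.
  have n1 : (1 < n)%N by rewrite -sq0.
  pose q' := c *: q - a *: 'X^(e - n) * q0.
  have gq' : map_poly g q' = g c *: map_poly g q - (g a *: 'X^(e - n)) * p0.
    by rewrite rmorphB rmorphM /= !map_polyZ /= map_polyXn.
  have : p0 %| map_poly g q'.
    apply: IH; last first.
      by rewrite rmorphB rmorphM /= !map_polyZ /= hornerD hornerN hornerM !hornerZ qy q0y !mulr0 subrr.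
    apply: leq_trans (_ : e <= _)%N; last exact: qk.
    have e1 : (0 < e)%N by lia.
    rewrite -(prednK e1) ltnS; apply/leq_sizeP => i ei.
    rewrite gq' coefB -scalerAl !coefZ coefXnM ltnNge (_ : e - n <= i)%N /=; last lia.
    move: ei; rewrite leq_eqVlt => /orP[/eqP <-|ei].
      have -> : (e.-1 - (e - n) = n.-1)%N by lia.
      by rewrite /p0 !coef_map -/a -/c mulrC subrr.
    rewrite [_`_i]nth_default; last by rewrite -/e; lia.
    by rewrite [p0`__]nth_default ?mulr0 ?subrr // sq0; lia.
  by rewrite gq' dvdp_subl ?dvdp_mull // dvdpZr.
have [M' [j [y' hy]]] := exists_root_extension p01.
exists M', j, y' => q /dvd hq; apply/eqP; rewrite map_poly_comp.
by apply: root_dvdp hy; rewrite dvdp_map.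
Qed.

End ExtendOne.

(** A partial homomorphism from [F] to [M] is represented by a ring [A] with maps
    [f] to [F] and [g] to [M] such that [g] kills the kernel of [f]; the pair
    is extended until every [y] in the list has a lift along [f'].  Each step replaces
    the ring by polynomials over it, the new variable lifting [y]. *)
Lemma extend_specialization_seq (F : fieldType) (ys : seq F) :
  forall (A : comNzRingType) (M : fieldType)
    (f : {rmorphism A -> F}) (g : {rmorphism A -> M}),
  (forall a, f a = 0 -> g a = 0) ->
  (forall y, y \in ys -> exists m : {poly A}, root (map_poly f m) y /\ g (lead_coef m) != 0) ->
  exists (A' : comNzRingType) (M' : fieldType) (e : {rmorphism A -> A'})
    (f' : {rmorphism A' -> F}) (g' : {rmorphism A' -> M'}) (j : {rmorphism M -> M'}),
  [/\ forall a, f' (e a) = f a, forall a, g' (e a) = j (g a),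
      forall a, f' a = 0 -> g' a = 0 & forall y, y \in ys -> exists a, f' a = y].
Proof.
elim: ys => [|y ys IH] A M f g kerfg hys.
  by exists A, M, idfun, f, g, idfun; split.
have [m [my gm]] := hys y (mem_head _ _).
have [M1 [j1 [y1 hy1]]] := extend_specialization kerfg my gm.
pose f1 : {rmorphism {poly A} -> F} := horner_morph (fun a => mulrC y (f a)).
pose g1 : {rmorphism {poly A} -> M1} := horner_morph (fun a => mulrC y1 ((j1 \o g) a)).
have f1E q : f1 q = (map_poly f q).[y] by [].
have g1E q : g1 q = (map_poly (j1 \o g) q).[y1] by [].
have f1C a : f1 a%:P = f a by rewrite f1E map_polyC hornerC.
have g1C a : g1 a%:P = j1 (g a) by rewrite g1E map_polyC hornerC.
have [||A' [M' [e [f' [g' [j [h1 h2 h3 h4]]]]]]] := IH _ _ f1 g1.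
- by move=> q; rewrite f1E g1E; exact: hy1.
- move=> z zys; have [|n [nz gn]] := hys z; first by rewrite inE zys orbT.
  exists (map_poly (@polyC A) n); split; last first.
    rewrite lead_coef_map_inj //; last exact: polyC_inj.
    by rewrite g1C fmorph_eq0.
  by rewrite -map_poly_comp (eq_map_poly f1C).
exists A', M', (e \o @polyC A), f', g', (j \o j1); split=> //=.
- by move=> a; rewrite h1 f1C.
- by move=> a; rewrite h2 g1C.
- move=> z; rewrite inE => /orP[/eqP ->|/h4 //].
  by exists (e 'X); rewrite h1 f1E map_polyX hornerX.
Qed.

Lemma eq_acl (K L : fieldType) (iota1 iota2 : {rmorphism K -> L}) S z :
  iota1 =1 iota2 -> acl iota1 S z -> acl iota2 S z.
Proof.
move=> e; apply: algebraic_over_sub => x hx F [sF FK] SF; apply: hx => //.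
by split=> // k; rewrite e.
Qed.

(** A dependency survives specialization as soon as one non-zero coefficient [a] of
    a relation expressing it stays non-zero.  This is guaranteed when the inverse
    [c] of [a] specializes too, since then the images of [a] and [c] have product 1. *)
Lemma span_specialization (K F : fieldType) (iota : {rmorphism K -> F}) (s : seq F) z :
  algebraic_pregeometry iota s z ->
  exists2 c, algebraic_pregeometry iota s c &
  forall (A : comNzRingType) (M : fieldType) (k : {rmorphism K -> A})
    (f : {rmorphism A -> F}) (g : {rmorphism A -> M}) (l : F -> A),
  (forall a, f (k a) = iota a) -> (forall a, f a = 0 -> g a = 0) ->
  (forall x, x \in [:: z, c & s] -> f (l x) = x) ->
  algebraic_pregeometry (g \o k) (map (g \o l) s) (g (l z)).
Proof.
rewrite -{1}(codom_nth s) => /span_codomP; set x := fun i : 'I_(size s) => nth 0 s i.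
have cx : codom x = s := codom_nth s.
move=> [q [q0 /eqP qz]].
have [i qi] : exists i, eval_at iota x q`_i != 0.
  exists (size (map_poly (eval_at iota x) q)).-1.
  by rewrite -coef_map -lead_coefE lead_coef_eq0.
exists (eval_at iota x q`_i)^-1.
  suff : algebraic_pregeometry iota (codom x) (eval_at iota x q`_i)^-1 by rewrite cx.
  apply/acl_codom.
  have sF := adjoin_subfield iota (fun y => exists i, y = x i).
  apply: acl_adjoin; rewrite -[_^-1]mul1r; apply: (subfield_div sF); first exact: subfield1.
  exact: eval_at_adjoin.
move=> A M k f g l fk kerfg hl; set c := _^-1 in hl.
pose E : {rmorphism {mpoly K[size s]} -> A} := mmap k (l \o x).
have xs i0 : x i0 \in s by exact: mem_nth.
have fE : f \o E =1 eval_at iota x.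
  apply: mpoly_rmorph_ext => [a|i0] /=; first by rewrite mmapC fk eval_atC.
  by rewrite mmapX mmap1U /= hl ?eval_atX // !inE xs !orbT.
have gE : g \o E =1 eval_at (g \o k) (g \o l \o x).
  apply: mpoly_rmorph_ext => [a|i0] /=; first by rewrite mmapC eval_atC.
  by rewrite mmapX mmap1U eval_atX.
have -> : map (g \o l) s = codom (g \o l \o x).
  by rewrite -[in LHS]cx /codom /image_mem -map_comp.
apply/span_codomP; exists q; split.
  have gqi : g (E q`_i * l c - 1) = 0.
    apply: kerfg; rewrite rmorphB rmorphM rmorph1 hl ?inE ?eqxx ?orbT //=.
    by rewrite [f (E _)]fE mulfV ?subrr.
  apply: contraTneq isT => h0.
  move/eqP: gqi; rewrite rmorphB rmorphM rmorph1 /= [g (E _)]gE -coef_map h0 coef0.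
  by rewrite mul0r sub0r oppr_eq0 oner_eq0.
apply/eqP; have : g ((map_poly E q).[l z]) = 0.
  apply: kerfg; rewrite -horner_map -map_poly_comp (eq_map_poly fE) hl ?inE ?eqxx //.
by rewrite -horner_map -map_poly_comp (eq_map_poly gE).
Qed.

Definition sublists (T : Type) (s : seq T) : seq (seq T) :=
  [seq mask (val m) s | m <- enum {: (size s).-tuple bool}].

Lemma filter_sublists (T : eqType) (p : pred T) (s : seq T) : filter p s \in sublists s.
Proof.
rewrite filter_mask; apply/mapP; exists (map_tuple p (in_tuple s)) => //.
by rewrite mem_enum.
Qed.

Lemma sublistsP (T : eqType) (s u : seq T) : u \in sublists s -> {subset u <= s}.
Proof. by case/mapP => m _ -> x; exact: mem_mask. Qed.

(** The elements to be specialized are those of [w], together with one inverse for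
    each dependency inside [w].  They are algebraic over [x], so each satisfies a
    relation with coefficients polynomial in [x], and [h] is the product of the leading
    coefficients of these relations. *)
Theorem specialization (K F : fieldType) (iota : {rmorphism K -> F})
    (d : nat) (x : 'I_d -> F) (w : seq F) :
  alg_independent iota x ->
  (forall y, y \in w -> algebraic_pregeometry iota (codom x) y) ->
  exists2 h : {mpoly K[d]}, h != 0 &
  forall (M : fieldType) (kappa : {rmorphism K -> M}) (v : 'I_d -> M),
  eval_at kappa v h != 0 ->
  exists (M' : fieldType) (j : {rmorphism M -> M'}) (phi : F -> M'),
    (forall i, phi (x i) = j (v i)) /\
    forall u y, {subset u <= w} -> y \in w -> algebraic_pregeometry iota u y ->
      algebraic_pregeometry (j \o kappa) (map phi u) (phi y).
Proof.
move=> xi wx; have x_inj := (alg_independentP iota x).1 xi.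
have /choice[C hC] : forall p : seq F * F, exists c, algebraic_pregeometry iota p.1 p.2 ->
    algebraic_pregeometry iota p.1 c /\
    forall (A : comNzRingType) (M : fieldType) (k : {rmorphism K -> A})
      (f : {rmorphism A -> F}) (g : {rmorphism A -> M}) (l : F -> A),
    (forall a, f (k a) = iota a) -> (forall a, f a = 0 -> g a = 0) ->
    (forall y, y \in [:: p.2, c & p.1] -> f (l y) = y) ->
    algebraic_pregeometry (g \o k) (map (g \o l) p.1) (g (l p.2)).
  move=> [u y] /=; have [/span_specialization[c c1 c2]|h] := pselect (algebraic_pregeometry iota u y).
    by exists c.
  by exists 0 => /h.
pose cs := [seq (if `[< algebraic_pregeometry iota p.1 p.2 >] then C p else 0)
  | p <- [seq (u, y) | u <- sublists w, y <- w]].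
pose ys := w ++ cs.
have ysx y : y \in ys -> exists m : {poly {mpoly K[d]}},
    m != 0 /\ root (map_poly (eval_at iota x) m) y.
  move=> hy; suff /span_codomP[m [m0 my]] : algebraic_pregeometry iota (codom x) y.
    by exists m; split=> //; apply: contraNneq m0 => ->; rewrite rmorph0.
  move: hy; rewrite mem_cat => /orP[/wx //|/mapP[[u z] /allpairsP[[u' z'] /= [hu hz [-> ->]]] ->]].
  case: asboolP => [h0|_].
    have [h _] := hC (u', z') h0.
    by apply: span_trans h => t /(sublistsP hu) /wx.
  exact: (subfield0 (acl_field _ _).1).
have /choice[m hm] : forall y, exists m : {poly {mpoly K[d]}}, y \in ys ->
    m != 0 /\ root (map_poly (eval_at iota x) m) y.
  move=> y; have [hy|hy] := boolP (y \in ys); last by exists 0.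
  by have [m hm] := ysx y hy; exists m.
exists (\prod_(y <- ys) lead_coef (m y)).
  rewrite prodf_seq_neq0; apply/allP => y /hm[m0 _] /=.
  by rewrite lead_coef_eq0.
move=> M kappa v; rewrite rmorph_prod prodf_seq_neq0 => /allP hv.
have [||A [M' [e [f [g [j [h1 h2 h3 h4]]]]]]] :=
    @extend_specialization_seq F ys _ _ (eval_at iota x) (eval_at kappa v).
- by move=> a /eqP; rewrite -(rmorph0 (eval_at iota x)) (inj_eq x_inj) => /eqP ->; rewrite rmorph0.
- by move=> y hy; exists (m y); split; [exact: (hm y hy).2 | exact: hv].
have /choice[l hl] : forall y, exists a, ((exists i, y = x i) \/ y \in ys) -> f a = y.
  move=> y; have [[[i ->]|/h4 [a ha]]|h] := pselect ((exists i, y = x i) \/ y \in ys).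
  - by exists (e 'X_i); rewrite h1 eval_atX.
  - by exists a.
  - by exists 0.
exists M', j, (g \o l); split=> [i|u y uw yw hy] /=.
  apply/eqP; rewrite -subr_eq0 -(eval_atX kappa v) -h2 -rmorphB; apply/eqP/h3.
  by rewrite rmorphB hl; [rewrite h1 eval_atX subrr | left; exists i].
pose k : {rmorphism K -> A} := e \o @mpolyC d K.
have fk a : f (k a) = iota a by rewrite /k /= h1 eval_atC.
pose u' := filter (mem u) w.
have u'E : u' =i u.
  by move=> t; rewrite mem_filter /=; case: (boolP (t \in u)) => // /uw.
have hy' : algebraic_pregeometry iota u' y by apply: span_sub hy => t; rewrite u'E.
have [_ hc] := hC (u', y) hy'.
apply: (@eq_acl _ _ (g \o k)) => [a|]; first by rewrite /k /= h2 eval_atC.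
apply: acl_sub (hc A M' k f g l fk h3 _) => [t /mapP[b]|t].
  by rewrite u'E => bu ->; exact: map_f.
move=> ht; apply: hl; right; rewrite mem_cat; move: ht.
rewrite !inE => /or3P[/eqP -> /=|/eqP ->|]; first by rewrite yw.
  apply/orP; right; apply/mapP; exists (u', y); last by rewrite asboolT.
  by apply/allpairsP; exists (u', y); split=> //; exact: filter_sublists.
by rewrite /= mem_filter => /andP[_ ->].
Qed.

(** * Sums of algebraic rank functions *)

(** Turns upper bounds for the rank of [s] and of [u] over [s] into equalities, once the
    rank of [u] is known from below. *)
Lemma rank_quotient (T : eqType) (G : pregeometry T) t s u : {subset s <= u} ->
  rank G t u = (rank G (s ++ t) u + rank G t s)%N.
Proof.
move=> su; rewrite -rank_cat; apply: rank_eq_mem => x.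
by rewrite mem_cat; case: (boolP (x \in s)) => [/su ->|]; rewrite ?orbF.
Qed.

Section BaseChange.
Variables (K L M : fieldType) (iota : {rmorphism K -> L}) (j : {rmorphism L -> M}).
Variable kappa : {rmorphism K -> M}.
Hypothesis kappaE : forall c, kappa c = j (iota c).

Lemma span_rmorph u y : algebraic_pregeometry iota u y ->
  algebraic_pregeometry kappa (map j u) (j y).
Proof.
move=> [p [p0 hp py]]; exists (map_poly j p); split.
- by rewrite map_poly_eq0.
- move=> i; rewrite coef_map /=.
  have [[sF1 sF2 sF3] FK] := adjoin_field kappa (fun x => x \in map j u).
  apply: (hp i (fun z => adjoin kappa (fun x => x \in map j u) (j z))).
    split=> [|k]; last by rewrite -kappaE.
    by split=> [|a b|a b]; rewrite ?rmorph1 // ?rmorphB ?fmorph_div; [exact: sF2 | exact: sF3].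
  by move=> x xu; apply: adjoin_id; exact: map_f.
- by rewrite fmorph_root.
Qed.

Lemma alg_independent_rmorph d (x : 'I_d -> L) :
  alg_independent iota x -> alg_independent kappa (j \o x).
Proof.
move=> /alg_independentP h; apply/alg_independentP; apply: rmorph_inj0 => p.
have -> : eval_at kappa (j \o x) p = j (eval_at iota x p).
  apply: (mpoly_rmorph_ext (f := eval_at kappa (j \o x)) (g := j \o eval_at iota x)) => [c|i] /=.
    by rewrite !eval_atC kappaE.
  by rewrite !eval_atX.
move/eqP; rewrite fmorph_eq0 => /eqP hp; apply: h; by rewrite hp rmorph0.
Qed.

(** Dependencies are preserved, and so is the independence of a basis. *)
Lemma rank_rmorph s :
  rank (algebraic_pregeometry kappa) [::] (map j s) = rank (algebraic_pregeometry iota) [::] s.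
Proof.
apply/eqP; rewrite eqn_leq; apply/andP; split.
  apply: (rank_map (t := [::])) => u x _ _; exact: span_rmorph.
have [b [bs br <- _]] := rank_basis (algebraic_pregeometry iota) [::] s.
have : rank (algebraic_pregeometry kappa) [::] (map j b) = size b.
  have -> : map j b = codom (j \o fun i : 'I_(size b) => nth 0 b i).
    by rewrite -[in LHS](codom_nth b) /codom /image_mem -map_comp.
  by apply/alg_independent_rank/alg_independent_rmorph/alg_independent_rank; rewrite codom_nth.
move=> <-; apply: leq_rank_sub => _ /mapP[x /bs xs ->]; exact: map_f.
Qed.

(** Dependence over [K] and the elements of [L] implies dependence over [L]. *)
Lemma leq_rank_base_field t s :
  (rank (algebraic_pregeometry j) [::] s <= rank (algebraic_pregeometry kappa) (map j t) s)%N.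
Proof.
have -> : rank (algebraic_pregeometry j) [::] s = rank (algebraic_pregeometry j) (map j t) s.
  apply: eq_rank_span => // _ /mapP[x _ ->]; exact: (acl_field _ _).2.
rewrite -[in leqLHS](map_id s) -[in leqLHS](map_id (map j t)).
apply: rank_map => u x _ _; rewrite !map_id.
apply: algebraic_over_sub => z hz F [sF FL] SF; apply: hz => //.
by split=> // k; rewrite kappaE.
Qed.
End BaseChange.

Section FractionField.
Variables (K : fieldType) (d : nat).
Definition mfrac_const : {rmorphism K -> {fraction {mpoly K[d]}}} :=
  @tofrac {mpoly K[d]} \o @mpolyC d K.
Definition mfrac_var (i : 'I_d) : {fraction {mpoly K[d]}} := tofrac 'X_i.

Lemma eval_at_mfrac p : eval_at mfrac_const mfrac_var p = tofrac p.
Proof.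
apply: (mpoly_rmorph_ext (f := eval_at mfrac_const mfrac_var) (g := @tofrac {mpoly K[d]})) => [c|i].
  by rewrite eval_atC.
by rewrite eval_atX.
Qed.

Lemma mfrac_independent : alg_independent mfrac_const mfrac_var.
Proof.
apply/alg_independentP; apply: rmorph_inj0 => p; rewrite eval_at_mfrac => /eqP.
by rewrite tofrac_eq0 => /eqP.
Qed.
End FractionField.

Section Sum.
Variables (K : fieldType) (E : finType).

(** The second family is specialized into a field over that of the first: a
    transcendence basis [b] of it goes to new variables over [L1].  The polynomial [h] to be
    avoided is non-zero with coefficients in [K], so it cannot vanish there.  The rank of each
    part, and of the whole over each part, is then at most what it should be, while the
    whole has full rank, so equality holds for every part. *)
Lemma realizable_add (r1 r2 : {set E} -> nat) : realizable K r1 -> realizable K r2 ->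
  realizable K (fun S => r1 S + r2 S)%N.
Proof.
move=> [L1 [iota1 [z1 hz1]]] [L2 [iota2 [z2 hz2]]].
pose U1 := union_seq z1; pose U2 := union_seq z2.
have [b [bw br bd wb]] := rank_basis (algebraic_pregeometry iota2) [::] (U2 [set: E]).
pose x (i : 'I_(size b)) := nth 0 b i.
have cx : codom x = b := codom_nth b.
have xi : alg_independent iota2 x by apply/alg_independent_rank; rewrite cx.
have [|h h0 hspec] := specialization (w := U2 [set: E]) xi.
  by move=> y /wb; rewrite cats0 cx.
pose inc := mfrac_const L1 (size b); pose v := @mfrac_var L1 (size b).
have hv : eval_at (inc \o iota1) v h != 0.
  have -> : eval_at (inc \o iota1) v h = eval_at inc v (map_mpoly iota1 h).
    apply: (mpoly_rmorph_ext (f := eval_at (inc \o iota1) v)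
      (g := eval_at inc v \o map_mpoly iota1)) => [c|i].
      by rewrite /= map_mpolyC !eval_atC.
    by rewrite /= map_mpolyX !eval_atX.
  rewrite eval_at_mfrac tofrac_eq0.
  apply: contraNneq h0 => hh; apply/eqP/mpolyP => m; apply: (fmorph_inj iota1).
  by rewrite -mcoeff_map_mpoly hh !mcoeff0 rmorph0.
have [M [j [phi [phix hphi]]]] := hspec _ _ _ hv.
pose kappa : {rmorphism K -> M} := j \o (inc \o iota1).
pose j1 : {rmorphism L1 -> M} := j \o inc.
have kE c : kappa c = j1 (iota1 c) by [].
pose G1 := algebraic_pregeometry iota1; pose G2 := algebraic_pregeometry iota2.
pose G := algebraic_pregeometry kappa.
exists M, kappa, (fun i => map j1 (z1 i) ++ map phi (z2 i)) => S.
rewrite -[in RHS]hz1 -hz2 -/(U1 S) -/(U2 S) -/G -/G1 -/G2.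
have memU R : union_seq (fun i => map j1 (z1 i) ++ map phi (z2 i)) R =i
    map j1 (U1 R) ++ map phi (U2 R).
  move=> y; rewrite mem_cat; apply/mem_union_seq/idP => [[i iR]|].
    rewrite mem_cat => /orP[/mapP[a az ->]|/mapP[a az ->]]; apply/orP; [left|right];
      by apply: map_f; apply/mem_union_seq; exists i.
  case/orP => /mapP[a /mem_union_seq[i iR ai] ->]; exists i; rewrite // mem_cat map_f ?orbT //.
have sub1 : {subset U1 S <= U1 setT} by exact/union_seq_sub/subsetT.
have sub2 : {subset U2 S <= U2 setT} by exact/union_seq_sub/subsetT.
have dep1 u y : G1 u y -> G (map j1 u) (j1 y) by exact: span_rmorph.
have rk1 t s : (rank G (map j1 t) (map j1 s) <= rank G1 t s)%N.
  by apply: rank_map => u y _ _; exact: dep1.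
have rk2 t s : {subset t <= U2 setT} -> {subset s <= U2 setT} ->
    (rank G (map phi t) (map phi s) <= rank G2 t s)%N.
  move=> ht hs; apply: rank_map => u y us ys; apply: hphi; last exact: hs.
  by move=> a; rewrite mem_cat => /orP[/us /hs|/ht].
have total : (rank G1 [::] (U1 setT) + rank G2 [::] (U2 setT) <=
    rank G [::] (map j1 (U1 setT) ++ map phi (U2 setT)))%N.
  rewrite rank_catC rank_cat cats0 addnC; apply: leq_add; last by rewrite (rank_rmorph kE).
  rewrite -/G2 in bd; rewrite -bd.
  apply: (@leq_trans (rank G (map j1 (U1 setT)) (map phi b))); last first.
    by apply: leq_rank_sub => _ /mapP[a /bw aU ->]; exact: map_f.
  apply: leq_trans (leq_rank_base_field kE _ _).
  have -> : map phi b = codom (j \o v).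
    transitivity (map phi (codom x)); first by rewrite cx.
    rewrite /codom /image_mem -map_comp; apply: eq_map => i /=; exact: phix.
  have /alg_independent_rank -> // : alg_independent j1 (j \o v).
  by apply: (alg_independent_rmorph (iota := inc)) => //; exact: mfrac_independent.
rewrite (rank_eq_mem _ _ (memU S)); apply/eqP; rewrite eqn_leq; apply/andP; split.
  apply: leq_trans (leq_rank_cat _ _ _ _) _; apply: leq_add; first exact: (rk1 [::]).
  by apply: (rk2 [::]).
have subs : {subset map j1 (U1 S) ++ map phi (U2 S) <= map j1 (U1 setT) ++ map phi (U2 setT)}.
  move=> y; rewrite !mem_cat => /orP[/mapP[a /sub1 aU ->]|/mapP[a /sub2 aU ->]].
    by rewrite map_f.
  by rewrite (map_f phi aU) orbT.
move: total; rewrite (rank_quotient G [::] subs).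
rewrite (rank_quotient G1 [::] sub1) (rank_quotient G2 [::] sub2) !cats0.
have := leq_rank_cat G (map j1 (U1 S) ++ map phi (U2 S)) (map j1 (U1 setT)) (map phi (U2 setT)).
have := rk1 (U1 S) (U1 setT); have := rk2 (U2 S) (U2 setT) sub2 (fun _ h => h).
have := @rank_le_base _ G (map j1 (U1 S)) (map j1 (U1 S) ++ map phi (U2 S))
  (map j1 (U1 setT)) (fun y h => etrans (mem_cat _ _ _) (introT orP (or_introl h))).
have := @rank_le_base _ G (map phi (U2 S)) (map j1 (U1 S) ++ map phi (U2 S))
  (map phi (U2 setT)) (fun y h => etrans (mem_cat _ _ _) (introT orP (or_intror h))).
have arith (t q1 q2 p1 p2 n1 n2 m1 m2 s1 : nat) : (p2 <= q2 -> p1 <= q1 ->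
    q2 <= n2 -> q1 <= n1 -> t <= p1 + p2 ->
    n1 + m1 + (n2 + m2) <= t + s1 -> m1 + m2 <= s1)%N by lia.
exact: arith.
Qed.
End Sum.

(** * Truncations of algebraic rank functions *)

(** If [t] avoids all the subfields in the list but lies in [V i], and [y] is not in [V i],
    then no element [t ^+ m.+1 + y] lies in [V i], and each of the other subfields
    contains at most one of them: the difference of two would make [t] algebraic
    over it.  This works over finite fields as well, where a
    linear combination of [t] and [y] would not do. *)
Lemma avoid_subfields (L : fieldType) (W : L -> Prop) (I : eqType) (V : I -> L -> Prop)
    (s : seq I) : is_subfield W -> (forall i, is_subfield (V i)) ->
  (forall i z, algebraic_over (V i) z -> V i z) ->
  (forall i, i \in s -> exists2 y, W y & ~ V i y) ->
  exists2 t, W t & forall i, i \in s -> ~ V i t.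
Proof.
move=> sW sV cV; elim: s => [_|i s IH h]; first by exists 0 => //; exact: subfield0.
have [|t Wt ht] := IH; first by move=> k ks; apply: h; rewrite inE ks orbT.
have [Vt|nVt] := pselect (V i t); last first.
  by exists t => // k; rewrite inE => /orP[/eqP ->|/ht].
have [y Wy nVy] := h i (mem_head _ _).
pose c m := t ^+ m.+1 + y.
have [[m hm]|bad] := pselect (exists m : 'I_(size s).+1, forall k, k \in s -> ~ V k (c m)).
  exists (c m); first by apply: (subfieldD sW) => //; exact: subfieldX.
  move=> k; rewrite inE => /orP[/eqP -> hc|/hm //]; apply: nVy.
  by rewrite -[y](addKr (t ^+ m.+1)) addrC; apply: (subfieldB (sV i)) => //; exact: subfieldX.
have /choice[f hf] : forall m : 'I_(size s).+1, exists k, k \in s /\ V k (c m).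
  move=> m; apply: contra_notP bad => hm; exists m => k ks hk; apply: hm; by exists k.
have f_inj : injective f.
  move=> m m' fmm'; apply/val_inj/eqP/negPn/negP => mm'.
  case: (ht (f m)) => //; first exact: (hf m).1.
  apply: cV; exists ('X^((val m).+1) - 'X^((val m').+1) - (c m - c m')%:P); split.
  - apply/eqP => /polyP /(_ (val m).+1); rewrite !coefB !coefXn coefC eqxx eqSS (negPf mm').
    by rewrite !subr0 coef0 => /eqP; rewrite oner_eq0.
  - have Vc : V (f m) (c m - c m').
      by apply: (subfieldB (sV _)); [|rewrite fmm']; exact: (hf _).2.
    have Vb (b : bool) : V (f m) b%:R.
      by case: b; [exact: subfield1 | exact: subfield0].
    move=> k; rewrite !coefB !coefXn coefC; apply: (subfieldB (sV _)).
      exact: (subfieldB (sV _)).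
    by case: ifP => // _; exact: (Vb false).
  - have -> : c m - c m' = t ^+ (val m).+1 - t ^+ (val m').+1.
      by rewrite /c opprD addrACA subrr addr0.
    by rewrite /root !hornerE subrr.
have : (size [seq f m | m <- enum 'I_(size s).+1] <= size s)%N.
  apply: uniq_leq_size; first by rewrite map_inj_uniq ?enum_uniq.
  by move=> _ /mapP[m _ ->]; exact: (hf m).1.
by rewrite size_map size_enum_ord ltnn.
Qed.

Lemma exists_algebraic_nonroot (K : fieldType) (c : {poly K}) : c != 0 ->
  exists (K' : fieldType) (j : {rmorphism K -> K'}) (tau : K'),
    algebraic_pregeometry j [::] tau /\ (map_poly j c).[tau] != 0.
Proof.
move=> c0.
(* A root [tau] of [c * 'X + 1] satisfies [tau * c(tau) = -1]. *)
pose p := c * 'X + 1%:P.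
have sp : (1 < size p)%N.
  by rewrite /p size_MXaddC (negPf c0) /= ltnS size_poly_gt0.
have [K' [j [tau rt]]] := exists_root_extension sp; exists K', j, tau; split.
  exists (map_poly j p); split=> //.
    by rewrite map_poly_eq0 -size_poly_gt0 (ltn_trans _ sp).
  by move=> i; rewrite coef_map; exact: adjoin_base.
apply: contraTneq rt => ct; rewrite /root /p rmorphD rmorphM /= map_polyX map_polyC.
by rewrite !hornerE ct mul0r add0r /= rmorph1 oner_eq0.
Qed.

(** The first [d] coordinates are independent variables.  As for the last, [h] is viewed as
    a polynomial in those variables with univariate coefficients, and the last
    coordinate only has to avoid the roots of one non-zero coefficient [c]. *)
Lemma exists_algebraic_point (K : fieldType) (d : nat) (h : {mpoly K[d.+1]}) : h != 0 ->
  exists (M : fieldType) (kappa : {rmorphism K -> M}) (v : 'I_d.+1 -> M),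
  [/\ eval_at kappa v h != 0, algebraic_pregeometry kappa [::] (v ord_max) &
      alg_independent kappa (fun i : 'I_d => v (widen_ord (leqnSn d) i))].
Proof.
move=> h0.
have mh0 : muni h != 0 by apply: contraNneq h0 => mh; rewrite -[h]muniK mh mmultiE rmorph0 horner0.
have [m hm] : exists m, (lead_coef (muni h))@_m != 0.
  apply: contra_notP (elimN eqP mh0) => hm; apply/eqP; rewrite -lead_coef_eq0.
  apply/eqP/mpolyP => m; rewrite mcoeff0; apply/eqP/negPn/negP => hn; apply: hm; by exists m.
pose c := map_poly (mcoeff m) (muni h).
have c0 : c != 0.
  apply: contraNneq hm => c0; rewrite lead_coefE -(coef_map (mcoeff m)) -/c c0 coef0 //.
have [K' [j [tau [tau_alg ctau]]]] := exists_algebraic_nonroot c0.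
pose inc := mfrac_const K' d; pose X := @mfrac_var K' d.
pose kappa : {rmorphism K -> {fraction {mpoly K'[d]}}} := inc \o j.
pose v (i : 'I_d.+1) := if unlift ord_max i is Some k then X k else inc tau.
have vmax : v ord_max = inc tau by rewrite /v unlift_none.
have vwid i : v (widen_ord (leqnSn d) i) = X i.
  have -> : widen_ord (leqnSn d) i = lift ord_max i.
    by apply/val_inj; rewrite /= /bump leqNgt ltn_ord.
  by rewrite /v liftK.
exists _, kappa, v; split; last 1 first.
- apply/alg_independentP; apply: rmorph_inj0 => p.
  have -> : eval_at kappa (fun i : 'I_d => v (widen_ord (leqnSn d) i)) p =
      eval_at inc X (map_mpoly j p).
    apply: (mpoly_rmorph_ext (f := eval_at kappa _) (g := eval_at inc X \o map_mpoly j)) => [a|i].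
      by rewrite /= map_mpolyC !eval_atC.
    by rewrite /= map_mpolyX !eval_atX vwid.
  rewrite eval_at_mfrac => /eqP; rewrite tofrac_eq0 => /eqP hp.
  apply/mpolyP => k; apply: (fmorph_inj j).
  by rewrite -mcoeff_map_mpoly hp !mcoeff0 rmorph0.
- pose q : {poly {mpoly K'[d]}} := map_poly (map_mpoly j) (muni h).
  have -> : eval_at kappa v h = tofrac (q.[tau%:MP]).
    rewrite -[in LHS](muniK h) eval_at_mmulti vmax -[inc tau]/(tofrac (tau%:MP)).
    rewrite -(horner_map (@tofrac {mpoly K'[d]})) /q -map_poly_comp; congr (_.[_]).
    apply: eq_map_poly => p.
    apply: (mpoly_rmorph_ext (f := eval_at kappa _) (g := @tofrac {mpoly K'[d]} \o map_mpoly j)) => [a|i].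
      by rewrite /= map_mpolyC !eval_atC.
    by rewrite /= map_mpolyX !eval_atX vwid.
  rewrite tofrac_eq0; apply: contraNneq ctau => hq.
  have <- : q.[tau%:MP]@_m = (map_poly j c).[tau]; last by rewrite hq mcoeff0.
  rewrite (horner_coef_wide _ (n := size (muni h))); last exact: size_poly.
  rewrite (horner_coef_wide tau (n := size (muni h))); last first.
    exact: leq_trans (size_poly _ _) (size_poly _ _).
  rewrite raddf_sum /=; apply: eq_bigr => i _.
  by rewrite -rmorphXn /= mulrC mcoeffCM mulrC !coef_map mcoeff_map_mpoly.
- by rewrite vmax; apply: (@span_rmorph _ _ _ j _ _ _ [::]).
Qed.

Section Truncation.
Variables (K : fieldType) (E : finType).

Lemma union_seq0 (T : eqType) (z : E -> seq T) : union_seq z set0 = [::].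
Proof. by rewrite /union_seq /image_mem enum_set0. Qed.

(** Take [t] algebraic over block [e], but over the elements indexed by [A] only if the
    whole block is.  Over [K(t)] the rank of [A] becomes its rank together with [t], minus
    one, which is the truncation.  To return to [K], specialize [t] to an element
    algebraic over [K] and the rest of a transcendence basis to variables: dependencies over
    [t] become dependencies over [K], and the total rank is preserved. *)
Lemma realizable_truncate (r : {set E} -> nat) (e : E) :
  realizable K r -> (0 < r [set e])%N ->
  realizable K (truncation r e).
Proof.
move=> [L [iota [z hz]]] re; pose G := algebraic_pregeometry iota; pose V := union_seq z.
have Vsub (A B : {set E}) : A \subset B -> {subset V A <= V B} by exact: union_seq_sub.
(* [avoid_subfields] is applied to the spans that miss some element of the block. *)
have [t te ht] : exists2 t, G (z e) t & forall A, G (V A) t -> forall y, y \in z e -> G (V A) y.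
  pose s := [seq A <- enum {: {set E}} | ~~ `[< forall y, y \in z e -> G (V A) y >]].
  have [||||t te ht] := @avoid_subfields L (G (z e)) _ (fun A => G (V A)) s.
  - exact: (acl_field _ _).1.
  - by move=> A; exact: (acl_field _ _).1.
  - by move=> A y; exact: acl_closed.
  - move=> A; rewrite mem_filter => /andP[/asboolPn nA _].
    apply: contra_notP nA => h y ye; apply: contra_notP h => ny.
    by exists y => //; exact: span_id.
  exists t => // A hA; apply: contrapT => hn; apply: (ht A) => //.
  by rewrite mem_filter mem_enum andbT; apply/asboolPn.
have nt : ~ G [::] t.
  rewrite -(union_seq0 z) => /ht h0; move: re; rewrite -hz rank_spanned // => y.
  case/mem_union_seq => i; rewrite inE => /eqP -> ye.
  by rewrite -(union_seq0 z); exact: h0.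
pose W := V setT.
have zW i : {subset z i <= W} by move=> y yi; apply/mem_union_seq; exists i; rewrite ?inE.
have [b [bW br bd Wb]] := rank_basis G [:: t] W.
set d := size b in br bd.
pose x (i : 'I_d.+1) := nth 0 (rcons b t) i.
have cx : codom x =i t :: b.
  move=> y; rewrite -mem_rcons; apply/codomP/(nthP 0) => [[i ->]|[i ib <-]].
    by exists (val i); rewrite ?size_rcons // ltn_ord.
  by rewrite size_rcons in ib; exists (Ordinal ib).
have xi : alg_independent iota x.
  apply/alg_independent_rank; rewrite (rank_eq_mem _ _ cx) -cat1s rank_catC rank_cat /=.
  by rewrite -/G br asboolF // addn1.
have [|h h0 hspec] := specialization (w := t :: W) xi.
  move=> y yW; apply/(span_eq_mem G y cx); move: yW; rewrite inE => /orP[/eqP ->|/Wb].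
    by apply: span_id; rewrite mem_head.
  by apply: span_sub => u; rewrite mem_cat !inE orbC.
have [M0 [kappa0 [v [hv vmax vi]]]] := exists_algebraic_point h0.
have [M [j [phi [phix hphi]]]] := hspec _ _ _ hv.
pose kappa : {rmorphism K -> M} := j \o kappa0; pose H := algebraic_pregeometry kappa.
have phit : H [::] (phi t).
  have -> : t = x ord_max by rewrite /x nth_rcons /= ltnn eqxx.
  by rewrite phix; apply: (@span_rmorph _ _ _ kappa0 _ _ _ [::]).
exists M, kappa, (fun i => map phi (z i)) => S; rewrite -/H.
have memU R : union_seq (fun i => map phi (z i)) R =i map phi (V R).
  move=> y; apply/mem_union_seq/mapP => [[i iR /mapP[a az ->]]|[a /mem_union_seq[i iR ai] ->]].
    by exists a => //; apply/mem_union_seq; exists i.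
  by exists i => //; exact: map_f.
rewrite (rank_eq_mem _ _ (memU S)) /truncation.
have VW : {subset V S <= W} by exact/Vsub/subsetT.
have bound u s : {subset u <= W} -> {subset s <= W} ->
    (rank H (map phi u) (map phi s) <= rank G (u ++ [:: t]) s)%N.
  move=> uW sW; have -> : rank H (map phi u) (map phi s) =
      rank H (map phi (u ++ [:: t])) (map phi s).
    apply: eq_rank_span => y; rewrite map_cat => yu.
      by apply: span_id; rewrite mem_cat yu.
    move: yu; rewrite mem_cat inE => /orP[yu|/eqP ->]; first exact: span_id.
    exact: span_sub phit.
  apply: rank_map => q y qs ys; apply: hphi; last by rewrite inE sW ?orbT.
  move=> a; rewrite !mem_cat !inE => /or3P[/qs /sW ->|/uW ->|->]; by rewrite ?orbT.
(* The elements of [b] go to independent variables. *)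
have total : (d <= rank H [::] (map phi W))%N.
  apply: (@leq_trans (rank H [::] (map phi b))); last first.
    by apply: leq_rank_sub => _ /mapP[a /bW aW ->]; exact: map_f.
  have -> : map phi b = codom (j \o fun i : 'I_d => v (widen_ord (leqnSn d) i)).
    transitivity (map phi (codom (fun i : 'I_(size b) => nth 0 b i))).
      by rewrite codom_nth.
    rewrite /codom /image_mem -map_comp; apply: eq_map => i /=; rewrite -phix /x /=.
    by rewrite nth_rcons ltn_ord.
  have /alg_independent_rank -> // : alg_independent kappa (j \o fun i : 'I_d => v (widen_ord (leqnSn d) i)).
  by apply: (alg_independent_rmorph (iota := kappa0)).
have rkS : rank H [::] (map phi (V S)) = rank G [:: t] (V S).
  apply/eqP; rewrite eqn_leq (bound [::]) //=.
  have sub : {subset map phi (V S) <= map phi W}.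
    by move=> _ /mapP[a /VW aW ->]; exact: map_f.
  move: total; rewrite bd (rank_quotient G [:: t] VW) (rank_quotient H [::] sub) cats0.
  have arith (k m p q : nat) : (k <= m -> m + p <= k + q -> p <= q)%N by lia.
  have := bound (V S) W VW (fun _ h => h); exact: arith.
rewrite rkS; have := hz S; have := hz (e |: S); rewrite -/G -/(V S) -/(V (e |: S)) => <- <-.
have -> : rank G [:: t] (V S) = (rank G [::] (V S) + ~~ `[< G (V S) t >] - 1)%N.
  have := rank_catC G [::] (V S) [:: t]; rewrite rank_cat /= !cats0.
  by rewrite [in X in (_ + X)%N]asboolF // => <-; rewrite addnK.
have sub : {subset V S <= V (e |: S)} by exact/Vsub/subsetUr.
have <- : `[< G (V S) t >] = (rank G [::] (V (e |: S)) == rank G [::] (V S)).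
  apply/asboolP/eqP => [hS|hS].
    apply: rank_span_eq => y; rewrite cats0; last by move=> /sub; exact: span_id.
    case/mem_union_seq => i; rewrite !inE => /orP[/eqP -> /ht|iS yi]; first exact.
    by apply: span_id; apply/mem_union_seq; exists i.
  apply: span_trans te => y ye; rewrite -[V S]cats0; apply: (rank_full sub) => //.
  by apply/mem_union_seq; exists e => //; rewrite !inE eqxx.
by case: `[< _ >]; rewrite /= ?addn0 ?addnK ?subn0.
Qed.
End Truncation.

(** * The theorem *)

Section Realize.
Local Open Scope nat_scope.
Variables (K : fieldType) (E : finType).

Lemma realizable_rank_like (r : {set E} -> nat) : realizable K r -> rank_like r.
Proof.
move=> [L [iota [z hz]]]; split=> [|A B AB|A B]; rewrite -!hz.
- by rewrite union_seq0.
- exact/leq_rank_sub/union_seq_sub.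
- apply: leq_trans (leq_rank_cat _ _ _ _); apply: leq_rank_sub => x /mem_union_seq[i].
  rewrite inE mem_cat => /orP[iA|iB] xi; apply/orP; [left|right]; by apply/mem_union_seq; exists i.
Qed.

(** Induction on the total number of cuts; a cut in a block of rank zero
    changes nothing. *)
Lemma realizable_reduction (r : {set E} -> nat) a : realizable K r -> realizable K (reduction r a).
Proof.
have [n] := ubnP (\sum_i a i); elim: n r a => // n IH r a an hr.
have rl := realizable_rank_like hr.
have [/existsP[e ae]|] := boolP [exists e, 0 < a e]; last first.
  rewrite negb_exists => /forallP a0; apply: eq_realizable hr => A; apply/esym.
  have -> : a = [ffun=> 0] by apply/ffunP => i; rewrite ffunE; have := a0 i; lia.
  exact: reduction0.
pose b : {ffun E -> nat} := [ffun i => a i - (i == e)].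
have ab : a = incr b e.
  by apply/ffunP => i; rewrite !ffunE; case: eqP => [->|] /=; lia.
have bn : \sum_i b i < n.
  have sT (m : {ffun E -> nat}) : \sum_(i in [set: E]) m i = \sum_i m i.
    by apply: eq_bigl => i; rewrite inE.
  by move: an; rewrite ab -!sT sum_incr inE addn1.
have [re|re] := posnP (r [set e]).
  by apply: eq_realizable (IH r b bn hr); rewrite ab; exact: reduction_loop.
apply: eq_realizable (IH _ b bn (realizable_truncate hr re)).
by rewrite ab; exact: reduction_truncation.
Qed.

End Realize.

Theorem proposition5p6 (K : fieldType) (n : nat) (P Q : polymatroid 'I_n)
    (alpha : {ffun 'I_n -> nat})
    (algP : algebraic_polymatroid K P) (algQ : algebraic_polymatroid K Q)
    (cageP : is_cage alpha P) (cageQ : is_cage alpha Q) :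
  algebraic_polymatroid K (polymatroid_intersection alpha P Q).
Proof.
apply: realizable_algebraic.
have hN := realizable_add (algebraic_realizable algP) (algebraic_realizable algQ).
apply: eq_realizable (realizable_reduction alpha hN) => A.
rewrite polymatroid_intersectionE /reduction /intersection_rk.
have h B : max_gap (fun S => P S + Q S)%N alpha B = max_excess alpha P Q B.
  by apply: eq_bigr => X _.
by rewrite !h.
Qed.
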